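(* Let $$\beta=\min_{k\in(k_0,1)}a_2(k,\tau_2(k)).$$ Then the minimum is attained, $\beta\in\left(\frac12,a_0\right)$, and the following holds. Given $a>0$, there exists $k\in(0,1)$ such that $U^+(a,k)$ or $U^-(a,k)$ intersects the unit circle orthogonally (at some $t>0$) if and only if $$a\in\left(0,\tfrac12\right)\cup[\beta,\infty).$$
   Context: In formulas with $\pm,\mp$, always take all upper signs or all lower signs. Undularies. For $a>0$ and $k\in(0,1)$ put $b=a\sqrt{1-k^2}$ and $c=\sqrt{a^2-b^2}=ak$. The two undularies symmetric with respect to the $y$-axis with these parameters are the plane curves $U^\pm(a,k)=(g^\pm_{\mathrm u},f^\pm_{\mathrm u})$, $$g^\pm_{\mathrm u}(t)=\int_0^t\sqrt{a^2-c^2\cos^2x}\,dx\mp\frac{c\sin t\,(a\mp c\cos t)}{\sqrt{a^2-c^2\cos^2t}},\qquad f^\pm_{\mathrm u}(t)=\frac{b(a\mp c\cos t)}{\sqrt{a^2-c^2\cos^2t}},\qquad t\in\mathbb R.$$ A curve $(g,f)$ intersects the unit circle orthogonally at $t>0$ if $g(t)^2+f(t)^2=1$ and $g'(t)f(t)-g(t)f'(t)=0$. For $0<k<1$, $t>0$ let $$I(k,t)=\int_0^t\sqrt{1-k^2\cos^2x}\,dx,\qquad F^+(k,t)=k\sin(t)\,I(k,t)-(1-k\cos t)\sqrt{1-k^2\cos^2t}.$$ Let $K(k)=\int_0^{\pi/2}\frac{dx}{\sqrt{1-k^2\sin^2x}}$, $E(k)=\int_0^{\pi/2}\sqrt{1-k^2\sin^2x}\,dx$,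 and let $\kappa_0\in(0,1)$ be the unique number with $2E(\kappa_0)=K(\kappa_0)$. Let $k_0$ be the unique number in $(0,\kappa_0)$ with $F^+(k_0,\frac{\pi}{2})=0$, and $a_0=\frac{k_0}{\sqrt{1-k_0^2}}$. For $k\in(k_0,1)$ let $t_2(k)$ be the unique number in $(\frac{\pi}{2},\pi)$ with $F^+(k,t_2(k))=0$, and set $$\tau_2(k)=\pi-t_2(k)\in\left(0,\tfrac{\pi}{2}\right),\qquad a_2(k,\tau_2(k))=\frac{k\sin\tau_2(k)}{\sqrt{1-k^2}\,(1+k\cos\tau_2(k))}.$$ (Existence and uniqueness of $\kappa_0,k_0,t_2(k)$ are known.) *)

(* Defs.v *)
From Stdlib Require Import Reals ClassicalEpsilon.
From Coquelicot Require Import Coquelicot.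
Open Scope R_scope.

(* The unique real number satisfying [P] (a junk value if there is none). *)
Definition the (P : R -> Prop) : R := epsilon (inhabits 0) (unique P).

(* [m] is the minimum of [h] on the open interval (l, u), and it is attained. *)
Definition is_min_on (h : R -> R) (l u m : R) : Prop :=
  (exists k, l < k < u /\ h k = m) /\ (forall k, l < k < u -> m <= h k).

(* The undularies: the real parameter [s] carries the sign, the upper signs
   being s = 1 and the lower signs s = -1; here b = a sqrt(1 - k^2) and
   c = sqrt(a^2 - b^2) = a k. *)
Definition gu (s a k t : R) : R :=
  let c := a * k in
  RInt (fun x => sqrt (a ^ 2 - c ^ 2 * cos x ^ 2)) 0 t
  - s * (c * sin t * (a - s * (c * cos t)) / sqrt (a ^ 2 - c ^ 2 * cos t ^ 2)).

Definition fu (s a k t : R) : R :=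
  let b := a * sqrt (1 - k ^ 2) in
  let c := a * k in
  b * (a - s * (c * cos t)) / sqrt (a ^ 2 - c ^ 2 * cos t ^ 2).

Definition curve : Type := (R -> R) * (R -> R).

Definition U_plus (a k : R) : curve := (gu 1 a k, fu 1 a k).
Definition U_minus (a k : R) : curve := (gu (-1) a k, fu (-1) a k).

Definition orthogonal_at (C : curve) (t : R) : Prop :=
  let (g, f) := C in
  g t ^ 2 + f t ^ 2 = 1 /\ Derive g t * f t - g t * Derive f t = 0.

Definition meets_unit_circle_orthogonally (C : curve) : Prop :=
  exists t, 0 < t /\ orthogonal_at C t.

Definition Ik (k t : R) : R := RInt (fun x => sqrt (1 - k ^ 2 * cos x ^ 2)) 0 t.

Definition F_plus (k t : R) : R :=
  k * sin t * Ik k t - (1 - k * cos t) * sqrt (1 - k ^ 2 * cos t ^ 2).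

Definition ellK (k : R) : R :=
  RInt (fun x => 1 / sqrt (1 - k ^ 2 * sin x ^ 2)) 0 (PI / 2).

Definition ellE (k : R) : R :=
  RInt (fun x => sqrt (1 - k ^ 2 * sin x ^ 2)) 0 (PI / 2).

Definition kappa0 : R := the (fun k => 0 < k < 1 /\ 2 * ellE k = ellK k).

Definition k0 : R := the (fun k => 0 < k < kappa0 /\ F_plus k (PI / 2) = 0).

Definition a0 : R := k0 / sqrt (1 - k0 ^ 2).

(* Meaningful for k0 < k < 1 only. *)
Definition t2 (k : R) : R := the (fun t => PI / 2 < t < PI /\ F_plus k t = 0).

Definition tau2 (k : R) : R := PI - t2 k.

Definition a2 (k tau : R) : R :=
  k * sin tau / (sqrt (1 - k ^ 2) * (1 + k * cos tau)).

(* Main.v *)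
(* Write D = speed, w = 1 - s k cos t and I = Ik k t. The undulary meets the unit circle orthogonally
   at t iff s k sin t I = w D and s k sin t = a sqrt (1 - k^2) w, and then 1 / a^2 = I^2 - w^2.

   If t >= pi, comparing arcs of an ellipse with chords gives I^2 > 4 + w^2, so a < 1/2. If t < pi,
   then s = 1 and F_plus k t = 0. The t-derivative of F_plus k is k cos t psi with psi > 0, so
   F_plus k increases on [0, pi/2] and decreases on [pi/2, pi], and has a zero iff
   F_plus k (pi/2) = k E(k) - 1 >= 0; as k E(k) is strictly concave with derivative 2E - K, this means
   k >= k0. Since I^2 - w^2 increases with t, the zero t2(k) in [pi/2, pi) gives the smaller a. This a
   is continuous in k on [k0, 1), tends to infinity at 1, and drops below its value a0 at k0 because
   t2(k) - pi/2 is of order sqrt (k - k0); so it has an interior minimum beta and takes all values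
   >= beta. It exceeds 1/2 because I^2 - w^2 < 4 E(k0)^2 - (1 + k0)^2 < 4.

   For 2n < 1/a <= 2n + 2 with n >= 1, put t = r + n pi and follow the curve of pairs (k, r) solving
   the second equation, parametrized by w: the first equation changes sign between (k, r) = (1, 0)
   and r = pi/2. *)
Require Import Defs.
From Stdlib Require Import Reals Lra Psatz ClassicalEpsilon.
From Coquelicot Require Import Coquelicot.
Open Scope R_scope.

(** * Arc length of the ellipse *)

(* Speed of the ellipse [(cos x, sqrt (1 - k ^ 2) * sin x)], whose arc length is [Ik k]. *)
Definition speed (k x : R) : R := sqrt (1 - k ^ 2 * cos x ^ 2).

Lemma speed_continuous (k x : R) : continuous (speed k) x.
Proof.
  apply continuous_sqrt_comp, (ex_derive_continuous (K := R_AbsRing) (V := R_NormedModule)).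
  auto_derive; trivial.
Qed.

Lemma ex_RInt_speed (k a b : R) : ex_RInt (speed k) a b.
Proof.
  apply (ex_RInt_continuous (V := R_CompleteNormedModule)).
  intros; apply speed_continuous.
Qed.

Lemma is_derive_Ik (k t : R) : is_derive (Ik k) t (speed k t).
Proof.
  apply (is_derive_RInt (V := R_NormedModule) (speed k) (Ik k) 0).
  - apply filter_forall; intros y.
    apply (RInt_correct (V := R_CompleteNormedModule)), ex_RInt_speed.
  - apply speed_continuous.
Qed.

Lemma cos2_sin2 (x : R) : cos x ^ 2 = 1 - sin x ^ 2.
Proof. pose proof (sin2_cos2 x). unfold Rsqr in *. lra. Qed.

Lemma speed_bounds (k x : R) : 0 <= speed k x <= 1.
Proof.
  split; [apply sqrt_pos|]. unfold speed. rewrite <- sqrt_1 at 2.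
  apply sqrt_le_1_alt. pose proof (pow2_ge_0 (k * cos x)). nra.
Qed.

Lemma speed_sqr_pos (k x : R) : 0 < k < 1 -> 0 < 1 - k ^ 2 * cos x ^ 2.
Proof. intros. pose proof (cos2_sin2 x). pose proof (pow2_ge_0 (sin x)). nra. Qed.

Lemma speed_sqr (k x : R) : 0 <= k <= 1 -> speed k x ^ 2 = 1 - k ^ 2 * cos x ^ 2.
Proof.
  intros. apply pow2_sqrt. pose proof (cos2_sin2 x). pose proof (pow2_ge_0 (sin x)).
  pose proof (pow2_ge_0 (cos x)). nra.
Qed.

Lemma speed_pos (k x : R) : 0 < k < 1 -> 0 < speed k x.
Proof. intros. apply sqrt_lt_R0, speed_sqr_pos; trivial. Qed.

Lemma Ik_0 (k : R) : Ik k 0 = 0.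
Proof. apply (RInt_point (V := R_CompleteNormedModule)). Qed.

Lemma Ik_lipschitz (k s t : R) : Rabs (Ik k t - Ik k s) <= Rabs (t - s).
Proof.
  destruct (MVT_gen (Ik k) s t (speed k)) as (c & _ & ->).
  - intros; apply is_derive_Ik.
  - intros. apply continuity_pt_filterlim.
    apply (ex_derive_continuous (K := R_AbsRing) (V := R_NormedModule)).
    eexists; apply is_derive_Ik.
  - rewrite Rabs_mult. pose proof (speed_bounds k c). rewrite (Rabs_pos_eq (speed k c)) by lra.
    pose proof (Rabs_pos (t - s)). nra.
Qed.

(** The radicand of [speed] can vanish at [k = 1], where the square root is not Lipschitz; a Hölder
    modulus survives there and makes every estimate in [k] uniform up to 1. Since [sqrt] is 0 on
    negative numbers, these form a case of their own. *)
Lemma sqrt_holder (x y : R) : Rabs (sqrt x - sqrt y) <= sqrt (Rabs (x - y)).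
Proof.
  assert (H : forall u v, u <= v -> sqrt v - sqrt u <= sqrt (v - u)).
  { intros u v L. destruct (Rle_lt_dec u 0).
    - rewrite (sqrt_neg_0 u) by trivial. rewrite Rminus_0_r.
      apply sqrt_le_1_alt; lra.
    - pose proof (sqrt_pos u). pose proof (sqrt_pos (v - u)).
      pose proof (sqrt_sqrt u ltac:(lra)). pose proof (sqrt_sqrt (v - u) ltac:(lra)).
      enough (sqrt v <= sqrt u + sqrt (v - u)) by lra.
      apply Rsqr_incr_0_var.
      + unfold Rsqr. rewrite sqrt_sqrt by lra. nra.
      + lra. }
  destruct (Rle_lt_dec x y).
  - rewrite Rabs_minus_sym, (Rabs_minus_sym x), !Rabs_pos_eq; auto.
    + lra.
    + apply Rge_le, Rge_minus, Rle_ge, sqrt_le_1_alt; trivial.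
  - rewrite !Rabs_pos_eq; auto.
    + apply H; lra.
    + lra.
    + apply Rge_le, Rge_minus, Rle_ge, sqrt_le_1_alt; lra.
Qed.

Lemma speed_modulus (k k' x : R) : Rabs (speed k x - speed k' x) <= sqrt (Rabs (k ^ 2 - k' ^ 2)).
Proof.
  unfold speed. eapply Rle_trans; [apply sqrt_holder|]. apply sqrt_le_1_alt.
  replace (_ - _) with ((k' ^ 2 - k ^ 2) * cos x ^ 2) by ring.
  rewrite Rabs_mult, (Rabs_pos_eq (cos x ^ 2)) by apply pow2_ge_0.
  rewrite (Rabs_minus_sym (k ^ 2)).
  pose proof (cos2_sin2 x). pose proof (pow2_ge_0 (sin x)).
  pose proof (Rabs_pos (k' ^ 2 - k ^ 2)). nra.
Qed.

Lemma Ik_modulus (k k' t : R) : 0 <= t ->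
  Rabs (Ik k t - Ik k' t) <= t * sqrt (Rabs (k ^ 2 - k' ^ 2)).
Proof.
  intros Ht. set (e := sqrt _).
  assert (H : Rabs (RInt (fun x => minus (speed k x) (speed k' x)) 0 t) <= (t - 0) * e).
  { apply abs_RInt_le_const; trivial.
    - apply (ex_RInt_minus (V := R_NormedModule)); apply ex_RInt_speed.
    - intros x _. apply speed_modulus. }
  rewrite (RInt_minus (V := R_CompleteNormedModule)) in H by apply ex_RInt_speed.
  rewrite Rminus_0_r in H. exact H.
Qed.

(** [speed k] has period [PI], so [Ik k (u + PI) - Ik k u] has derivative 0 in [u]. *)
Lemma Ik_shift_PI (k t : R) : 0 <= t -> Ik k (t + PI) = Ik k PI + Ik k t.
Proof.
  intros [Ht | <-]; [|rewrite Ik_0, Rplus_0_l; ring].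
  enough (Ik k (0 + PI) - Ik k 0 = Ik k (t + PI) - Ik k t)
    by (rewrite Ik_0, Rplus_0_l in *; lra).
  apply (eq_is_derive (V := R_NormedModule) (fun u => Ik k (u + PI) - Ik k u)); trivial.
  intros v _. unfold zero; simpl.
  replace 0 with (1 * speed k (v + PI) - speed k v)
    by (unfold speed; rewrite neg_cos; replace ((- cos v) ^ 2) with (cos v ^ 2) by ring; ring).
  apply (is_derive_minus (K := R_AbsRing) (V := R_NormedModule)); [|apply is_derive_Ik].
  apply (is_derive_comp (K := R_AbsRing) (V := R_NormedModule) (Ik k) (fun u => u + PI)).
  - apply is_derive_Ik.
  - auto_derive; trivial; ring.
Qed.

Lemma Ik_PI (k : R) : Ik k PI = 2 * Ik k (PI / 2).
Proof.
  pose proof PI_RGT_0.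
  enough (Ik k (PI - 0) + Ik k 0 = Ik k (PI - PI / 2) + Ik k (PI / 2))
    by (rewrite Ik_0, Rminus_0_r in *; replace (PI - PI / 2) with (PI / 2) in * by field; lra).
  apply (eq_is_derive (V := R_NormedModule) (fun u => Ik k (PI - u) + Ik k u)); [|lra].
  intros v _. unfold zero; simpl.
  replace 0 with (- 1 * speed k (PI - v) + speed k v)
    by (unfold speed; rewrite Rtrigo_facts.cos_pi_minus;
        replace ((- cos v) ^ 2) with (cos v ^ 2) by ring; ring).
  apply (is_derive_plus (K := R_AbsRing) (V := R_NormedModule)); [|apply is_derive_Ik].
  apply (is_derive_comp (K := R_AbsRing) (V := R_NormedModule) (Ik k) (fun u => PI - u)).
  - apply is_derive_Ik.
  - auto_derive; trivial; ring.
Qed.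

(** The substitution [x -> PI / 2 - x] exchanges sine and cosine; it is carried out through the
    antiderivative [- Ik k (PI / 2 - x)]. *)
Lemma ellE_Ik (k : R) : ellE k = Ik k (PI / 2).
Proof.
  replace (Ik k (PI / 2)) with (minus (- Ik k (PI / 2 - PI / 2)) (- Ik k (PI / 2 - 0)))
    by (rewrite Rminus_diag, Rminus_0_r, Ik_0; unfold minus, plus, opp; simpl; ring).
  apply is_RInt_unique.
  apply (is_RInt_derive (V := R_CompleteNormedModule) (fun x => - Ik k (PI / 2 - x))).
  - intros x _. replace (sqrt _) with (- (- 1 * speed k (PI / 2 - x)))
      by (unfold speed; rewrite cos_shift; ring).
    apply (is_derive_opp (K := R_AbsRing) (V := R_NormedModule)).
    apply (is_derive_comp (K := R_AbsRing) (V := R_NormedModule) (Ik k) (fun u => PI / 2 - u)).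
    + apply is_derive_Ik.
    + auto_derive; trivial; ring.
  - intros x _. apply continuous_sqrt_comp.
    apply (ex_derive_continuous (K := R_AbsRing) (V := R_NormedModule)).
    auto_derive; trivial.
Qed.

Lemma continuous_of_modulus (f g : R -> R) (x : R) :
  (forall y, Rabs (f y - f x) <= g y) -> continuous g x -> g x = 0 -> continuous f x.
Proof.
  intros H Hg H0. apply continuity_pt_filterlim in Hg. apply continuity_pt_filterlim.
  intros e He. destruct (Hg e He) as (d & Hd & K). exists d; split; trivial.
  intros y Hy. specialize (K y Hy). simpl in *. unfold R_dist in *.
  rewrite H0, Rminus_0_r in K. pose proof (H y). pose proof (Rle_abs (g y)). lra.
Qed.

(** The increment splits into a change of modulus at a fixed upper limit ([Ik_modulus]) and a change
    of the upper limit ([Ik_lipschitz]). The result also covers points where [f x = 1]. *)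
Lemma continuous_Ik_comp (f g : R -> R) (x : R) :
  (forall y, 0 <= g y) -> continuous f x -> continuous g x ->
  continuous (fun y => Ik (f y) (g y)) x.
Proof.
  intros H0 Hf Hg.
  apply (continuous_of_modulus _
    (fun y => g y * sqrt (Rabs (f y ^ 2 - f x ^ 2)) + Rabs (g y - g x))).
  - intros y. replace (_ - _) with ((Ik (f y) (g y) - Ik (f x) (g y))
      + (Ik (f x) (g y) - Ik (f x) (g x))) by ring.
    eapply Rle_trans; [apply Rabs_triang|]. apply Rplus_le_compat.
    + apply Ik_modulus; trivial.
    + apply Ik_lipschitz.
  - apply (continuous_plus (V := R_NormedModule)).
    + apply (continuous_mult (K := R_AbsRing)); trivial.
      apply continuous_sqrt_comp.
      apply continuous_Rabs_comp.
      apply (continuous_minus (V := R_NormedModule)); [|apply continuous_const].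
      apply (continuous_comp f (fun u => u ^ 2)); trivial.
      apply (ex_derive_continuous (K := R_AbsRing) (V := R_NormedModule)).
      auto_derive; trivial.
    + apply continuous_Rabs_comp.
      apply (continuous_minus (V := R_NormedModule)); trivial. apply continuous_const.
  - rewrite !Rminus_diag, Rabs_R0, sqrt_0. ring.
Qed.

Ltac real_eq := match goal with |- ?x = ?y => change (@eq R x y) end.

(** * Monotonicity of [F_plus] in [t] *)

Lemma is_derive_speed (k t : R) : 0 < k < 1 ->
  is_derive (speed k) t (k ^ 2 * cos t * sin t / speed k t).
Proof.
  intros Hk. pose proof (speed_sqr_pos k t Hk) as H. pose proof (speed_pos k t Hk).
  evar_last.
  - apply (is_derive_comp sqrt (fun t => 1 - k ^ 2 * cos t ^ 2)).
    + apply is_derive_Reals, derivable_pt_lim_sqrt; trivial.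
    + auto_derive; trivial.
  - unfold scal; simpl; unfold mult; simpl. fold (speed k t) in *.
    change (sqrt _) with (speed k t). field. lra.
Qed.

(** This quotient is the ordinate [fu] divided by [a * sqrt (1 - k ^ 2)]. Once the denominators are
    cleared, [speed_sqr] and [s ^ 2 = 1] leave a polynomial identity. *)
Lemma is_derive_profile (s k t : R) : 0 < k < 1 -> s ^ 2 = 1 ->
  is_derive (fun t => (1 - s * (k * cos t)) / speed k t) t
    (s * k * sin t * (1 - s * (k * cos t)) / speed k t ^ 3).
Proof.
  intros Hk Hs. pose proof (speed_pos k t Hk) as HD.
  pose proof (speed_sqr k t ltac:(lra)) as HD2.
  evar_last.
  - apply (is_derive_div (fun t => 1 - s * (k * cos t)) (speed k) t (s * (k * sin t)));
      [|apply is_derive_speed; trivial|lra].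
    auto_derive; trivial; ring.
  - generalize dependent (speed k t); intros D HD HD2.
    apply (Rmult_eq_reg_r (D ^ 3)); [|apply pow_nonzero; lra].
    field_simplify; try lra.
    rewrite HD2, Hs. ring.
Qed.

Lemma is_derive_abscissa (s k t : R) : 0 < k < 1 -> s ^ 2 = 1 ->
  is_derive (fun t => Ik k t - s * (k * sin t * (1 - s * (k * cos t)) / speed k t)) t
    ((1 - k ^ 2) * (1 - s * (k * cos t)) / speed k t ^ 3).
Proof.
  intros Hk Hs. pose proof (speed_pos k t Hk) as HD.
  pose proof (speed_sqr k t ltac:(lra)) as HD2. pose proof (cos2_sin2 t) as HC.
  apply (is_derive_ext (fun t => Ik k t - s * (k * sin t) * ((1 - s * (k * cos t)) / speed k t))).
  { intros; real_eq; unfold Rdiv; ring. }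
  evar_last.
  - apply (is_derive_minus (K := R_AbsRing) (V := R_NormedModule)); [apply is_derive_Ik|].
    apply (is_derive_mult (fun t => s * (k * sin t))); [|apply is_derive_profile; trivial|].
    + auto_derive; trivial.
    + intros; real_eq; unfold mult; simpl; ring.
  - unfold minus, plus, opp, mult; simpl.
    generalize dependent (speed k t); intros D HD HD2.
    apply (Rmult_eq_reg_r (D ^ 3)); [|apply pow_nonzero; lra].
    field_simplify; try lra.
    replace (D ^ 4) with ((D ^ 2) ^ 2) by ring. replace (s ^ 3) with (s * s ^ 2) by ring.
    replace (sin t ^ 2) with (1 - cos t ^ 2) by lra. rewrite HD2, Hs. ring.
Qed.

(* The abscissa of the undulary [U_plus], divided by [a] *)
Definition psi (k t : R) : R := Ik k t - k * sin t * (1 - k * cos t) / speed k t.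

Lemma is_derive_psi (k t : R) : 0 < k < 1 ->
  is_derive (psi k) t ((1 - k ^ 2) * (1 - k * cos t) / speed k t ^ 3).
Proof.
  intros Hk. pose proof (is_derive_abscissa 1 k t Hk ltac:(ring)) as H.
  rewrite Rmult_1_l in H. revert H. apply is_derive_ext.
  intros; real_eq; unfold psi. now rewrite !Rmult_1_l.
Qed.

Lemma kcos_bounds (k t : R) : 0 < k < 1 -> - k <= k * cos t <= k.
Proof. intros. pose proof (COS_bound t). nra. Qed.

Lemma increasing_of_derive (f df : R -> R) (x y : R) : x < y ->
  (forall z, x <= z <= y -> is_derive f z (df z)) ->
  (forall z, x < z < y -> 0 < df z) -> f x < f y.
Proof.
  intros Hxy Hd Hp. destruct (MVT_cor2 f df x y Hxy) as (c & E & Hc).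
  - intros c Hc. apply is_derive_Reals; auto.
  - specialize (Hp c Hc). nra.
Qed.

Lemma psi_pos (k t : R) : 0 < k < 1 -> 0 < t -> 0 < psi k t.
Proof.
  intros Hk Ht.
  replace 0 with (psi k 0) by (unfold psi; rewrite Ik_0, sin_0; unfold Rdiv; ring).
  apply (increasing_of_derive (psi k)
    (fun t => (1 - k ^ 2) * (1 - k * cos t) / speed k t ^ 3)); trivial.
  - intros; apply is_derive_psi; trivial.
  - intros z _. pose proof (kcos_bounds k z Hk). pose proof (speed_pos k z Hk).
    apply Rdiv_lt_0_compat; [apply Rmult_lt_0_compat; nra | apply pow_lt; trivial].
Qed.

Lemma psi_speed (k t : R) : 0 < k < 1 ->
  Ik k t * speed k t - k * sin t * (1 - k * cos t) = psi k t * speed k t.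
Proof. intros Hk. pose proof (speed_pos k t Hk). unfold psi. field. lra. Qed.

(** In the product rule the two terms [k * sin t * speed k t] cancel, and [k * cos t] factors out of
    the rest. *)
Lemma is_derive_F_plus (k t : R) : 0 < k < 1 ->
  is_derive (F_plus k) t (k * cos t * psi k t).
Proof.
  intros Hk. pose proof (speed_pos k t Hk) as HD.
  evar_last.
  - apply (is_derive_minus (K := R_AbsRing) (V := R_NormedModule)
      (fun t => k * sin t * Ik k t) (fun t => (1 - k * cos t) * speed k t)).
    + apply (is_derive_mult (fun t => k * sin t) (Ik k) t (k * cos t));
        [|apply is_derive_Ik|intros; real_eq; unfold mult; simpl; ring].
      auto_derive; trivial; ring.
    + apply (is_derive_mult (fun t => 1 - k * cos t) (speed k) t (k * sin t));
        [|apply is_derive_speed; trivial|intros; real_eq; unfold mult; simpl; ring].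
      auto_derive; trivial; ring.
  - real_eq. unfold minus, plus, opp, mult, psi; simpl. field. lra.
Qed.

Lemma is_derive_Ik2_w2 (k t : R) : 0 < k < 1 ->
  is_derive (fun t => Ik k t ^ 2 - (1 - k * cos t) ^ 2) t (2 * (psi k t * speed k t)).
Proof.
  intros Hk. rewrite <- psi_speed by trivial.
  evar_last.
  - apply (is_derive_minus (K := R_AbsRing) (V := R_NormedModule)).
    + apply (is_derive_pow (Ik k) 2), is_derive_Ik.
    + apply (is_derive_pow (fun t => 1 - k * cos t) 2 t (k * sin t)).
      auto_derive; trivial; ring.
  - real_eq. unfold minus, plus, opp; simpl. ring.
Qed.

(** At an intersection this quantity equals [1 / a ^ 2], so for fixed [k] a later intersection
    belongs to a smaller [a]. *)
Lemma Ik2_w2_lt (k s t : R) : 0 < k < 1 -> 0 <= s < t ->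
  Ik k s ^ 2 - (1 - k * cos s) ^ 2 < Ik k t ^ 2 - (1 - k * cos t) ^ 2.
Proof.
  intros Hk Hst.
  apply (increasing_of_derive (fun t => Ik k t ^ 2 - (1 - k * cos t) ^ 2)
    (fun t => 2 * (psi k t * speed k t))); try lra.
  - intros; apply is_derive_Ik2_w2; trivial.
  - intros z Hz. pose proof (psi_pos k z Hk ltac:(lra)). pose proof (speed_pos k z Hk). nra.
Qed.

Lemma F_plus_incr (k s t : R) : 0 < k < 1 -> 0 <= s < t -> t <= PI / 2 ->
  F_plus k s < F_plus k t.
Proof.
  intros Hk Hst Ht.
  apply (increasing_of_derive (F_plus k) (fun t => k * cos t * psi k t)); try lra.
  - intros; apply is_derive_F_plus; trivial.
  - intros z Hz. pose proof (psi_pos k z Hk ltac:(lra)).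
    pose proof (cos_gt_0 z ltac:(lra) ltac:(lra)).
    apply Rmult_lt_0_compat; nra.
Qed.

Lemma F_plus_decr (k s t : R) : 0 < k < 1 -> PI / 2 <= s < t -> t <= PI ->
  F_plus k t < F_plus k s.
Proof.
  intros Hk Hst Ht. pose proof PI_RGT_0. apply Ropp_lt_cancel.
  apply (increasing_of_derive (fun t => - F_plus k t) (fun t => - (k * cos t * psi k t))); try lra.
  - intros; apply (is_derive_opp (K := R_AbsRing) (V := R_NormedModule)), is_derive_F_plus; trivial.
  - intros z Hz. pose proof (psi_pos k z Hk ltac:(lra)).
    pose proof (cos_lt_0 z ltac:(lra) ltac:(lra)).
    assert (0 < (k * - cos z) * psi k z) by (apply Rmult_lt_0_compat; nra). lra.
Qed.

Lemma F_plus_PI2 (k : R) : F_plus k (PI / 2) = k * ellE k - 1.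
Proof.
  unfold F_plus. rewrite sin_PI2, cos_PI2, ellE_Ik.
  replace (1 - k ^ 2 * 0 ^ 2) with 1 by ring. rewrite sqrt_1. ring.
Qed.

Lemma F_plus_PI (k : R) : 0 < k < 1 -> F_plus k PI < 0.
Proof.
  intros Hk. unfold F_plus. rewrite sin_PI. pose proof (speed_pos k PI Hk) as H.
  unfold speed in H. rewrite cos_PI in *. nra.
Qed.

Lemma F_plus_le_PI2 (k t : R) : 0 < k < 1 -> 0 <= t <= PI -> F_plus k t <= F_plus k (PI / 2).
Proof.
  intros Hk Ht. destruct (Rtotal_order t (PI / 2)) as [H | [-> | H]].
  - left; apply F_plus_incr; lra.
  - apply Rle_refl.
  - left; apply F_plus_decr; lra.
Qed.

(** * The two intersection equations *)

(* The first equation is orthogonality; given it, [g ^ 2 + f ^ 2 = 1] turns into the second. *)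
Definition hits (s a k t : R) : Prop :=
  s * k * sin t * Ik k t = (1 - s * (k * cos t)) * speed k t /\
  s * k * sin t = a * sqrt (1 - k ^ 2) * (1 - s * (k * cos t)).

Lemma Ik_lt (k s t : R) : 0 < k < 1 -> s < t -> Ik k s < Ik k t.
Proof.
  intros Hk Hst. apply (increasing_of_derive (Ik k) (speed k)); trivial.
  - intros; apply is_derive_Ik.
  - intros; apply speed_pos; trivial.
Qed.

Lemma Ik_pos (k t : R) : 0 < k < 1 -> 0 < t -> 0 < Ik k t.
Proof. intros. rewrite <- (Ik_0 k). apply Ik_lt; trivial. Qed.

Lemma sqrt_scaled_speed (a k t : R) : 0 < a ->
  sqrt (a ^ 2 - (a * k) ^ 2 * cos t ^ 2) = a * speed k t.
Proof.
  intros Ha. replace (a ^ 2 - _) with (a ^ 2 * (1 - k ^ 2 * cos t ^ 2)) by ring.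
  rewrite sqrt_mult_alt by apply pow2_ge_0. rewrite sqrt_pow2 by lra. reflexivity.
Qed.

Lemma fu_eq (s a k t : R) : 0 < a -> 0 < k < 1 ->
  fu s a k t = a * sqrt (1 - k ^ 2) * ((1 - s * (k * cos t)) / speed k t).
Proof.
  intros Ha Hk. unfold fu. rewrite sqrt_scaled_speed by trivial.
  pose proof (speed_pos k t Hk). field. lra.
Qed.

Lemma gu_eq (s a k t : R) : 0 < a -> 0 < k < 1 ->
  gu s a k t = a * (Ik k t - s * (k * sin t * (1 - s * (k * cos t)) / speed k t)).
Proof.
  intros Ha Hk. unfold gu. rewrite sqrt_scaled_speed by trivial.
  pose proof (speed_pos k t Hk).
  rewrite (RInt_ext (V := R_CompleteNormedModule) _ (fun x => scal a (speed k x))).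
  - rewrite (RInt_scal (V := R_CompleteNormedModule)) by apply ex_RInt_speed.
    change (RInt (speed k) 0 t) with (Ik k t). unfold scal; simpl; unfold mult; simpl.
    field. lra.
  - intros x _. apply sqrt_scaled_speed; trivial.
Qed.

Lemma Derive_fu (s a k t : R) : 0 < a -> 0 < k < 1 -> s ^ 2 = 1 ->
  Derive (fu s a k) t
    = a * sqrt (1 - k ^ 2) * (s * k * sin t * (1 - s * (k * cos t)) / speed k t ^ 3).
Proof.
  intros Ha Hk Hs. apply is_derive_unique.
  eapply is_derive_ext; [intros; symmetry; apply fu_eq; trivial|].
  apply is_derive_scal, is_derive_profile; trivial.
Qed.

Lemma Derive_gu (s a k t : R) : 0 < a -> 0 < k < 1 -> s ^ 2 = 1 ->
  Derive (gu s a k) t = a * ((1 - k ^ 2) * (1 - s * (k * cos t)) / speed k t ^ 3).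
Proof.
  intros Ha Hk Hs. apply is_derive_unique.
  eapply is_derive_ext; [intros; symmetry; apply gu_eq; trivial|].
  apply is_derive_scal, is_derive_abscissa; trivial.
Qed.

Lemma minor_axis (k : R) : 0 < k < 1 -> 0 < sqrt (1 - k ^ 2) /\ sqrt (1 - k ^ 2) ^ 2 = 1 - k ^ 2.
Proof. intros. split; [apply sqrt_lt_R0 | apply pow2_sqrt]; nra. Qed.

Lemma sign_cases (s : R) : s ^ 2 = 1 -> s = 1 \/ s = -1.
Proof. intros. destruct (Rle_lt_dec 0 s); [left|right]; nra. Qed.

Lemma w_pos (s k t : R) : 0 < k < 1 -> s ^ 2 = 1 -> 0 < 1 - s * (k * cos t).
Proof.
  intros Hk Hs. pose proof (kcos_bounds k t Hk). destruct (sign_cases s Hs) as [-> | ->]; lra.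
Qed.

Lemma speed_sqr_legs (s k t : R) : 0 < k < 1 -> s ^ 2 = 1 ->
  speed k t ^ 2 = sqrt (1 - k ^ 2) ^ 2 + (s * k * sin t) ^ 2.
Proof.
  intros Hk Hs. rewrite speed_sqr, (proj2 (minor_axis k Hk)), cos2_sin2 by lra.
  replace ((s * k * sin t) ^ 2) with (s ^ 2 * (k * sin t) ^ 2) by ring.
  rewrite Hs. ring.
Qed.

(** With [p = s k sin t] and [b = sqrt (1 - k ^ 2)], the orthogonality expression is a positive
    multiple of [w D - p I]. If it vanishes, then [p > 0], and [D ^ 2 = b ^ 2 + p ^ 2] collapses
    [g ^ 2 + f ^ 2] to [(a b w / p) ^ 2], which is 1 exactly when [p = a b w]. *)
Lemma orthogonal_hits (s a k t : R) : 0 < a -> 0 < k < 1 -> s ^ 2 = 1 -> 0 < t ->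
  orthogonal_at (gu s a k, fu s a k) t <-> hits s a k t.
Proof.
  intros Ha Hk Hs Ht. unfold orthogonal_at, hits.
  rewrite Derive_fu, Derive_gu, fu_eq, gu_eq by trivial.
  pose proof (minor_axis k Hk) as [Hb Hb2].
  pose proof (speed_pos k t Hk) as HD. pose proof (Ik_pos k t Hk Ht) as HI.
  pose proof (speed_sqr_legs s k t Hk Hs) as HD2.
  pose proof (w_pos s k t Hk Hs) as Hw.
  replace (s * (k * sin t * (1 - s * (k * cos t)) / speed k t))
    with (s * k * sin t * (1 - s * (k * cos t)) / speed k t) by (field; lra).
  set (w := 1 - s * (k * cos t)) in *. set (p := s * k * sin t) in *.
  set (b := sqrt (1 - k ^ 2)) in *. rewrite <- Hb2.
  set (D := speed k t) in *. set (I := Ik k t) in *.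
  clearbody w p b D I. clear - Ha Hb HD HI HD2 Hw.
  assert (E : a * (b ^ 2 * w / D ^ 3) * (a * b * (w / D))
      - a * (I - p * w / D) * (a * b * (p * w / D ^ 3))
      = a ^ 2 * b * w / D ^ 3 * (w * D - p * I)).
  { replace (w * D) with (w * D ^ 2 / D) by (field; lra). rewrite HD2. field. lra. }
  rewrite E.
  assert (HC : 0 < a ^ 2 * b * w / D ^ 3).
  { apply Rdiv_lt_0_compat; [repeat apply Rmult_lt_0_compat; nra | apply pow_lt; trivial]. }
  assert (HP : p * I = w * D ->
    (a * (I - p * w / D)) ^ 2 + (a * b * (w / D)) ^ 2 = (a * b * w / p) ^ 2 /\ 0 < p).
  { intros H. assert (0 < p) by (apply (Rmult_lt_reg_r I); nra). split; trivial.
    replace I with (w * D / p) by (rewrite <- H; field; lra).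
    replace (w * D / p - p * w / D) with (w * (D ^ 2 - p ^ 2) / (p * D)) by (field; lra).
    replace (D ^ 2 - p ^ 2) with (b ^ 2) by lra.
    replace (_ + _) with ((a * b * w) ^ 2 * (b ^ 2 + p ^ 2) / (p ^ 2 * D ^ 2)) by (field; lra).
    rewrite <- HD2. field. lra. }
  split.
  - intros [H1 H2].
    assert (H : p * I = w * D).
    { apply Rmult_integral in H2. destruct H2; lra. }
    split; trivial. destruct (HP H) as [H3 Hp].
    assert (0 < a * b * w / p).
    { apply Rdiv_lt_0_compat; trivial. repeat apply Rmult_lt_0_compat; trivial. }
    assert (H4 : a * b * w / p = 1) by nra.
    apply (Rmult_eq_reg_r (/ p)); [|apply Rinv_neq_0_compat; lra].
    rewrite Rinv_r by lra. symmetry. exact H4.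
  - intros [H ->]. destruct (HP H) as [H3 Hp].
    split; [|rewrite H; ring].
    rewrite H3. field. split; nra.
Qed.

(** Dividing the first equation by [w], after inserting the second, gives [a b I = D]; then
    [D ^ 2 = b ^ 2 + (a b w) ^ 2] is the claim times [a ^ 2 b ^ 2]. *)
Lemma hits_length (s a k t : R) : 0 < a -> 0 < k < 1 -> s ^ 2 = 1 -> hits s a k t ->
  Ik k t ^ 2 - (1 - s * (k * cos t)) ^ 2 = / a ^ 2.
Proof.
  intros Ha Hk Hs [H1 H2].
  pose proof (minor_axis k Hk) as [Hb Hb2].
  pose proof (speed_sqr_legs s k t Hk Hs) as HD2.
  pose proof (w_pos s k t Hk Hs) as Hw.
  rewrite H2 in *.
  set (w := 1 - s * (k * cos t)) in *. set (b := sqrt (1 - k ^ 2)) in *.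
  set (D := speed k t) in *. set (I := Ik k t) in *. clearbody w b D I.
  assert (H : a * b * I = D) by (apply (Rmult_eq_reg_l w); lra).
  rewrite <- H in HD2.
  apply (Rmult_eq_reg_l (a ^ 2 * b ^ 2)); [|apply Rgt_not_eq; repeat apply Rmult_lt_0_compat; nra].
  replace (a ^ 2 * b ^ 2 * / a ^ 2) with (b ^ 2) by (field; lra). lra.
Qed.

(** * The complete elliptic integrals, [kappa0] and [k0] *)

Lemma PI_lower : 314 / 100 < PI.
Proof.
  pose proof (proj1 (PI_2_3_7_ineq 1)) as H.
  unfold sum_f_R0, tg_alt, PI_2_3_7_tg, Ratan_seq in H; simpl in H. lra.
Qed.

Lemma PI_upper : PI < 315 / 100.
Proof.
  pose proof (proj2 (PI_2_3_7_ineq 1)) as H.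
  unfold sum_f_R0, tg_alt, PI_2_3_7_tg, Ratan_seq in H; simpl in H. lra.
Qed.

(** At [k = 1] the ellipse degenerates to a segment traversed with speed [sin x]. *)
Lemma Ik_1 (t : R) : 0 <= t <= PI -> Ik 1 t = 1 - cos t.
Proof.
  intros Ht. replace (1 - cos t) with (minus (- cos t) (- cos 0))
    by (rewrite cos_0; unfold minus, plus, opp; simpl; ring).
  apply is_RInt_unique.
  apply (is_RInt_ext (V := R_NormedModule) sin).
  - intros x Hx. rewrite Rmin_left, Rmax_right in Hx by lra.
    rewrite cos2_sin2. replace (1 - 1 ^ 2 * (1 - sin x ^ 2)) with (sin x ^ 2) by ring.
    symmetry; apply sqrt_pow2. apply sin_ge_0; lra.
  - apply (is_RInt_derive (V := R_CompleteNormedModule) (fun x => - cos x)).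
    + intros x _. auto_derive; trivial; ring.
    + intros x _. apply continuous_sin.
Qed.

Lemma ellE_1 : ellE 1 = 1.
Proof. pose proof PI_RGT_0. rewrite ellE_Ik, Ik_1, cos_PI2; lra. Qed.

(** Supplies the integrals of the polynomial bounds on [speed] in [ellE_lower] and [ellE_upper]. *)
Lemma is_RInt_cos_even (A B C : R) :
  is_RInt (fun x => A + B * cos x ^ 2 + C * cos x ^ 4) 0 (PI / 2)
    (PI / 2 * (A + B / 2 + 3 * C / 8)).
Proof.
  set (f := fun x => A * x + B * (x / 2 + sin x * cos x / 2)
    + C * (3 * x / 8 + 3 * (sin x * cos x) / 8 + sin x * cos x ^ 3 / 4)).
  replace (PI / 2 * _) with (minus (f (PI / 2)) (f 0)).
  2:{ unfold f, minus, plus, opp; simpl. rewrite sin_0, cos_PI2. field. }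
  apply (is_RInt_derive (V := R_CompleteNormedModule) f).
  - intros x _. unfold f. auto_derive; trivial.
    replace (cos x ^ 4) with ((cos x ^ 2) ^ 2) by ring. field_simplify.
    replace (sin x ^ 2) with (1 - cos x ^ 2) by (pose proof (cos2_sin2 x); lra). field.
  - intros x _. apply (ex_derive_continuous (K := R_AbsRing) (V := R_NormedModule)).
    auto_derive; trivial.
Qed.

(* By Cauchy-Schwarz, [sin x ^ 2 + sqrt (1 - k ^ 2) * cos x ^ 2], the component of the velocity
   [(- sin x, sqrt (1 - k ^ 2) * cos x)] along the unit circle's tangent, bounds [speed k x]. *)
Lemma ellE_lower (k : R) : 0 <= k <= 1 -> PI / 4 * (1 + sqrt (1 - k ^ 2)) <= ellE k.
Proof.
  intros Hk. pose proof PI_RGT_0. rewrite ellE_Ik. set (b := sqrt _).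
  pose proof (is_RInt_cos_even 1 (b - 1) 0) as HR.
  replace (PI / 4 * (1 + b)) with (PI / 2 * (1 + (b - 1) / 2 + 3 * 0 / 8)) by field.
  rewrite <- (is_RInt_unique _ _ _ _ HR). apply RInt_le; [lra| |apply ex_RInt_speed|].
  { eexists; exact HR. }
  intros x _. assert (Hb : 0 <= b) by apply sqrt_pos.
  assert (Hb2 : b ^ 2 = 1 - k ^ 2) by (apply pow2_sqrt; nra).
  assert (HC : 0 <= cos x ^ 2 <= 1).
  { pose proof (cos2_sin2 x). pose proof (pow2_ge_0 (sin x)). pose proof (pow2_ge_0 (cos x)). lra. }
  assert (b <= 1) by nra.
  rewrite <- (sqrt_pow2 (1 + _ + _)) by nra.
  apply sqrt_le_1_alt. replace (k ^ 2) with (1 - b ^ 2) by lra.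
  generalize dependent (cos x ^ 2). intros c HC.
  assert (0 <= (1 - b) ^ 2 * (c * (1 - c))) by (apply Rmult_le_pos; nra). nra.
Qed.

(** Integrates [sqrt (1 - y) <= 1 - y / 2 - y ^ 2 / 8], the Taylor polynomial of degree 2, at
    [y = k ^ 2 cos x ^ 2]. *)
Lemma ellE_upper (k : R) : 0 <= k <= 1 ->
  ellE k <= PI / 2 * (1 - k ^ 2 / 4 - 3 * k ^ 4 / 64).
Proof.
  intros Hk. pose proof PI_RGT_0. rewrite ellE_Ik.
  pose proof (is_RInt_cos_even 1 (- k ^ 2 / 2) (- k ^ 4 / 8)) as HR.
  replace (PI / 2 * _) with (PI / 2 * (1 + - k ^ 2 / 2 / 2 + 3 * (- k ^ 4 / 8) / 8)) by field.
  rewrite <- (is_RInt_unique _ _ _ _ HR). apply RInt_le; [lra|apply ex_RInt_speed| |].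
  { eexists; exact HR. }
  intros x _.
  assert (HC : 0 <= cos x ^ 2 <= 1).
  { pose proof (cos2_sin2 x). pose proof (pow2_ge_0 (sin x)). pose proof (pow2_ge_0 (cos x)). lra. }
  replace (1 + _ + _) with (1 - (k ^ 2 * cos x ^ 2) / 2 - (k ^ 2 * cos x ^ 2) ^ 2 / 8) by field.
  unfold speed.
  assert (Hy : 0 <= k ^ 2 * cos x ^ 2 <= 1) by nra.
  set (y := k ^ 2 * cos x ^ 2) in *. clearbody y.
  rewrite <- (sqrt_pow2 (1 - y / 2 - y ^ 2 / 8)) by nra.
  apply sqrt_le_1_alt.
  replace ((1 - y / 2 - y ^ 2 / 8) ^ 2) with (1 - y + y ^ 2 * (y / 8 + y ^ 2 / 64)) by field.
  assert (0 <= y ^ 2 * (y / 8 + y ^ 2 / 64)) by (apply Rmult_le_pos; nra). lra.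
Qed.

(** The derivative of [k * ellE k]. It enters only as the slope of the tangent in [concavity], which
    avoids differentiating under the integral sign; [kappa0] is its zero. *)
Definition ellM (k : R) : R := 2 * ellE k - ellK k.

Lemma sin2_bounds (x : R) : 0 <= sin x ^ 2 <= 1.
Proof.
  pose proof (cos2_sin2 x). pose proof (pow2_ge_0 (sin x)). pose proof (pow2_ge_0 (cos x)). lra.
Qed.

Lemma continuous_E_integrand (k x : R) : continuous (fun x => sqrt (1 - k ^ 2 * sin x ^ 2)) x.
Proof.
  apply continuous_sqrt_comp, (ex_derive_continuous (K := R_AbsRing) (V := R_NormedModule)).
  auto_derive; trivial.
Qed.

Lemma E_integrand_pos (k x : R) : 0 < k < 1 -> 0 < sqrt (1 - k ^ 2 * sin x ^ 2).
Proof. intros. pose proof (sin2_bounds x). apply sqrt_lt_R0. nra. Qed.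

Lemma continuous_K_integrand (k x : R) : 0 < k < 1 ->
  continuous (fun x => 1 / sqrt (1 - k ^ 2 * sin x ^ 2)) x.
Proof.
  intros Hk. apply (continuous_mult (K := R_AbsRing)); [apply continuous_const|].
  apply continuous_Rinv_comp; [apply continuous_E_integrand|].
  pose proof (E_integrand_pos k x Hk). lra.
Qed.

(* AM-GM reduces the claim to [0 <= (k - q)^2 * (k + 2 * q)]. *)
Lemma concavity_integrand (k q y : R) : 0 < k <= 1 -> 0 < q < 1 -> k <> q -> 0 < y < 1 ->
  k * sqrt (1 - k ^ 2 * y)
    < (2 * k - q) * sqrt (1 - q ^ 2 * y) - (k - q) * (1 / sqrt (1 - q ^ 2 * y)).
Proof.
  intros Hk Hq Hkq Hy.
  assert (Hv : 0 < 1 - q ^ 2 * y) by nra.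
  pose proof (sqrt_lt_R0 _ Hv) as Hsv. pose proof (sqrt_sqrt (1 - q ^ 2 * y) ltac:(lra)) as Ev.
  pose proof (sqrt_pos (1 - k ^ 2 * y)) as Hsu.
  pose proof (sqrt_sqrt (1 - k ^ 2 * y) ltac:(nra)) as Eu.
  set (u := sqrt (1 - k ^ 2 * y)) in *. set (v := sqrt (1 - q ^ 2 * y)) in *.
  apply (Rmult_lt_reg_r v); trivial.
  replace (((2 * k - q) * v - (k - q) * (1 / v)) * v) with ((2 * k - q) * (v * v) - (k - q))
    by (field; lra).
  assert (2 * (u * v) <= u * u + v * v) by (pose proof (pow2_ge_0 (u - v)); lra).
  assert (0 < y * ((k - q) ^ 2 * (k + 2 * q))).
  { apply Rmult_lt_0_compat; [lra|]. apply Rmult_lt_0_compat; [|lra].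
    apply pow2_gt_0; lra. }
  assert (k * (2 * (u * v)) <= k * (u * u + v * v)) by (apply Rmult_le_compat_l; lra).
  rewrite Ev, Eu in *. nra.
Qed.

(** The tangent inequality at [q], obtained by integrating [concavity_integrand]. Allowing [k = 1]
    brings in the known value [ellE 1 = 1]. *)
Lemma concavity (k q : R) : 0 < k <= 1 -> 0 < q < 1 -> k <> q ->
  k * ellE k < q * ellE q + ellM q * (k - q).
Proof.
  intros Hk Hq Hkq. pose proof PI_RGT_0.
  assert (HE : forall p, is_RInt (fun x => sqrt (1 - p ^ 2 * sin x ^ 2)) 0 (PI / 2) (ellE p)).
  { intros p. apply (RInt_correct (V := R_CompleteNormedModule)).
    apply (ex_RInt_continuous (V := R_CompleteNormedModule)).
    intros; apply continuous_E_integrand. }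
  assert (HK : is_RInt (fun x => 1 / sqrt (1 - q ^ 2 * sin x ^ 2)) 0 (PI / 2) (ellK q)).
  { apply (RInt_correct (V := R_CompleteNormedModule)).
    apply (ex_RInt_continuous (V := R_CompleteNormedModule)).
    intros; apply continuous_K_integrand; trivial. }
  pose proof (is_RInt_scal (V := R_NormedModule) _ _ _ k _ (HE k)) as H1.
  pose proof (is_RInt_minus (V := R_NormedModule) _ _ _ _ _ _
    (is_RInt_scal (V := R_NormedModule) _ _ _ (2 * k - q) _ (HE q))
    (is_RInt_scal (V := R_NormedModule) _ _ _ (k - q) _ HK)) as H2.
  assert (E1 : RInt (fun x => k * sqrt (1 - k ^ 2 * sin x ^ 2)) 0 (PI / 2) = k * ellE k)
    by exact (is_RInt_unique _ _ _ _ H1).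
  assert (E2 : RInt (fun x => (2 * k - q) * sqrt (1 - q ^ 2 * sin x ^ 2)
      - (k - q) * (1 / sqrt (1 - q ^ 2 * sin x ^ 2))) 0 (PI / 2)
    = (2 * k - q) * ellE q - (k - q) * ellK q) by exact (is_RInt_unique _ _ _ _ H2).
  replace (q * ellE q + _) with ((2 * k - q) * ellE q - (k - q) * ellK q)
    by (unfold ellM; ring).
  rewrite <- E1, <- E2.
  apply RInt_lt; [lra| | |].
  - intros x _. apply (continuous_minus (V := R_NormedModule));
      apply (continuous_scal_r (V := R_NormedModule));
      [apply continuous_E_integrand | apply continuous_K_integrand; trivial].
  - intros x _. apply (continuous_scal_r (V := R_NormedModule)), continuous_E_integrand.
  - intros x Hx. apply concavity_integrand; trivial.
    assert (0 < sin x) by (apply sin_gt_0; lra). assert (0 < cos x) by (apply cos_gt_0; lra).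
    pose proof (cos2_sin2 x). nra.
Qed.

(** Adding the tangent inequalities at [k] and at [q] leaves [0 < (ellM k - ellM q) * (q - k)]. *)
Lemma ellM_decr (k q : R) : 0 < k < q -> q < 1 -> ellM q < ellM k.
Proof.
  intros Hk Hq.
  pose proof (concavity k q ltac:(lra) ltac:(lra) ltac:(lra)).
  pose proof (concavity q k ltac:(lra) ltac:(lra) ltac:(lra)). nra.
Qed.

Lemma ellE_continuous (k : R) : continuous ellE k.
Proof.
  pose proof PI_RGT_0.
  apply (continuous_ext (fun y => Ik y (PI / 2))); [intros; symmetry; apply ellE_Ik|].
  apply (continuous_Ik_comp (fun y => y) (fun _ => PI / 2)); [intros; lra| |].
  - apply continuous_id.
  - apply continuous_const.
Qed.

(** In [1 / u - 1 / v = (v - u) / (u v)] the numerator obeys the Hölder bound, and the cap [m] keeps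
    [u v >= 1 - m ^ 2]. *)
Lemma ellK_modulus (k k' m : R) : 0 < k <= m -> 0 < k' <= m -> m < 1 ->
  Rabs (ellK k - ellK k') <= PI / 2 * (sqrt (Rabs (k ^ 2 - k' ^ 2)) / (1 - m ^ 2)).
Proof.
  intros Hk Hk' Hm. pose proof PI_RGT_0. unfold ellK.
  assert (HI : forall p, 0 < p <= m ->
    ex_RInt (fun x => 1 / sqrt (1 - p ^ 2 * sin x ^ 2)) 0 (PI / 2)).
  { intros p Hp. apply (ex_RInt_continuous (V := R_CompleteNormedModule)).
    intros; apply continuous_K_integrand; lra. }
  change (Rabs (minus (RInt (fun x => 1 / sqrt (1 - k ^ 2 * sin x ^ 2)) 0 (PI / 2))
    (RInt (fun x => 1 / sqrt (1 - k' ^ 2 * sin x ^ 2)) 0 (PI / 2)))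
    <= PI / 2 * (sqrt (Rabs (k ^ 2 - k' ^ 2)) / (1 - m ^ 2))).
  rewrite <- (RInt_minus (V := R_CompleteNormedModule)) by auto.
  replace (PI / 2 * _) with ((PI / 2 - 0) * (sqrt (Rabs (k ^ 2 - k' ^ 2)) / (1 - m ^ 2))) by ring.
  apply abs_RInt_le_const; [lra| |].
  { apply (ex_RInt_minus (V := R_NormedModule)); auto. }
  intros x _. unfold minus, plus, opp; simpl.
  pose proof (sin2_bounds x) as HS.
  pose proof (E_integrand_pos k x ltac:(lra)) as Hu.
  pose proof (E_integrand_pos k' x ltac:(lra)) as Hv.
  pose proof (sqrt_holder (1 - k' ^ 2 * sin x ^ 2) (1 - k ^ 2 * sin x ^ 2)) as Hd.
  pose proof (sqrt_sqrt (1 - k ^ 2 * sin x ^ 2) ltac:(nra)) as Eu.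
  pose proof (sqrt_sqrt (1 - k' ^ 2 * sin x ^ 2) ltac:(nra)) as Ev.
  assert (Hr : sqrt (Rabs (1 - k' ^ 2 * sin x ^ 2 - (1 - k ^ 2 * sin x ^ 2)))
    <= sqrt (Rabs (k ^ 2 - k' ^ 2))).
  { apply sqrt_le_1_alt. replace (_ - _) with ((k ^ 2 - k' ^ 2) * sin x ^ 2) by ring.
    rewrite Rabs_mult, (Rabs_pos_eq (sin x ^ 2)) by lra.
    pose proof (Rabs_pos (k ^ 2 - k' ^ 2)). nra. }
  simpl in *.
  set (u := sqrt (1 - k * (k * 1) * (sin x * (sin x * 1)))) in *.
  set (v := sqrt (1 - k' * (k' * 1) * (sin x * (sin x * 1)))) in *.
  assert (Huv : 1 - m * (m * 1) <= u * v).
  { assert (sqrt (1 - m * m) <= u) by (apply sqrt_le_1_alt; nra).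
    assert (sqrt (1 - m * m) <= v) by (apply sqrt_le_1_alt; nra).
    pose proof (sqrt_pos (1 - m * m)). pose proof (sqrt_sqrt (1 - m * m) ltac:(nra)). nra. }
  replace (1 / u + - (1 / v)) with ((v - u) / (u * v)) by (field; lra).
  unfold Rdiv. rewrite Rabs_mult, (Rabs_pos_eq (/ (u * v)))
    by (left; apply Rinv_0_lt_compat; nra).
  apply Rmult_le_compat; try apply Rabs_pos.
  - left; apply Rinv_0_lt_compat; nra.
  - lra.
  - apply Rinv_le_contravar; nra.
Qed.

Lemma ellK_continuous (k : R) : 0 < k < 1 -> continuous ellK k.
Proof.
  intros Hk. set (m := (1 + k) / 2).
  set (g := fun y => PI / 2 * (sqrt (Rabs (y ^ 2 - k ^ 2)) / (1 - m ^ 2))).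
  assert (Hg : continuous g k).
  { apply (continuous_mult (K := R_AbsRing)); [apply continuous_const|].
    apply (continuous_mult (K := R_AbsRing)); [|apply continuous_const].
    apply continuous_sqrt_comp, continuous_Rabs_comp.
    apply (ex_derive_continuous (K := R_AbsRing) (V := R_NormedModule)).
    auto_derive; trivial. }
  assert (Hg0 : g k = 0).
  { unfold g. rewrite Rminus_diag, Rabs_R0, sqrt_0. unfold Rdiv; ring. }
  apply continuity_pt_filterlim in Hg. apply continuity_pt_filterlim.
  intros e He. destruct (Hg e He) as (d & Hd & H).
  exists (Rmin d (Rmin k (m - k))). split.
  { repeat apply Rmin_glb_lt; trivial; unfold m; lra. }
  intros y [Hy1 Hy2]. simpl in *. unfold R_dist in *.
  assert (Hy : 0 < y <= m).
  { pose proof (Rmin_r d (Rmin k (m - k))). pose proof (Rmin_l k (m - k)).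
    pose proof (Rmin_r k (m - k)). apply Rabs_def2 in Hy2. lra. }
  pose proof (Rmin_l d (Rmin k (m - k))).
  specialize (H y). rewrite Hg0, Rminus_0_r in H.
  assert (Hy3 : Rabs (y - k) < d) by lra.
  specialize (H (conj Hy1 Hy3)).
  eapply Rle_lt_trans; [|exact H].
  eapply Rle_trans; [|apply Rle_abs].
  apply ellK_modulus; unfold m in *; lra.
Qed.

Lemma ellM_continuous (k : R) : 0 < k < 1 -> continuous ellM k.
Proof.
  intros Hk. apply (continuous_minus (V := R_NormedModule)).
  - apply (continuous_mult (K := R_AbsRing)); [apply continuous_const | apply ellE_continuous].
  - apply ellK_continuous; trivial.
Qed.

(** The point 4/5 makes [sqrt (1 - k ^ 2)] rational. The excess 0.004 over the value 1 at [k = 1] is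
    what [ellM_neg] consumes. *)
Lemma kE_4_5 : 1004 / 1000 < 4 / 5 * ellE (4 / 5).
Proof.
  pose proof PI_lower. pose proof (ellE_lower (4 / 5) ltac:(lra)) as HE.
  replace (1 - (4 / 5) ^ 2) with ((3 / 5) ^ 2) in HE by field.
  rewrite sqrt_pow2 in HE by lra. lra.
Qed.

Lemma kE_1_2 : 1 / 2 * ellE (1 / 2) < 8 / 10.
Proof. pose proof PI_upper. pose proof (ellE_upper (1 / 2) ltac:(lra)). nra. Qed.

(** [k * ellE k] is larger at 4/5 than at 1/2, so its tangent at 1/2 must rise. *)
Lemma ellM_1_2 : 0 < ellM (1 / 2).
Proof.
  pose proof kE_4_5. pose proof kE_1_2.
  pose proof (concavity (4 / 5) (1 / 2) ltac:(lra) ltac:(lra) ltac:(lra)). lra.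
Qed.

(** Take [q] with [sqrt (1 - q ^ 2) = 1 / 1000]. By [Ik_modulus], [ellE q] exceeds 1 by at most
    [PI / 2000], so [q * ellE q] lies below its value at 4/5, and the tangent at [q] must fall. *)
Lemma ellM_neg : exists q, 4 / 5 < q < 1 /\ ellM q < 0.
Proof.
  set (q := sqrt (1 - (1 / 1000) ^ 2)).
  assert (Hq2 : q ^ 2 = 1 - (1 / 1000) ^ 2) by (apply pow2_sqrt; lra).
  assert (Hq0 : 0 <= q) by apply sqrt_pos.
  assert (Hq : 4 / 5 < q < 1) by nra.
  clearbody q. exists q; split; trivial.
  pose proof PI_upper. pose proof PI_RGT_0. pose proof kE_4_5.
  pose proof (Ik_modulus q 1 (PI / 2) ltac:(lra)) as H2.
  rewrite <- !ellE_Ik, ellE_1, Hq2 in H2.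
  replace (1 - (1 / 1000) ^ 2 - 1 ^ 2) with (- (1 / 1000) ^ 2) in H2 by ring.
  rewrite Rabs_Ropp, (Rabs_pos_eq (_ ^ 2)), sqrt_pow2 in H2 by lra.
  pose proof (Rle_abs (ellE q - 1)).
  pose proof (concavity (4 / 5) q ltac:(lra) ltac:(lra) ltac:(lra)). nra.
Qed.

Lemma the_spec (P : R -> Prop) (x : R) : P x -> (forall y, P y -> y = x) -> the P = x.
Proof.
  intros Hx Hu.
  assert (H : unique P (the P)).
  { apply (epsilon_spec (inhabits 0) (unique P)). exists x. split; trivial. intros y Hy; symmetry; auto. }
  apply Hu, H.
Qed.

Lemma ellM_root : exists k, 1 / 2 < k < 1 /\ ellM k = 0.
Proof.
  destruct ellM_neg as (q & Hq & HM). pose proof ellM_1_2.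
  destruct (Ranalysis5.IVT_interv (fun k => - ellM k) (1 / 2) q) as (k & Hk & E); try lra.
  - intros k Hk. apply continuity_pt_opp, continuity_pt_filterlim, ellM_continuous; lra.
  - exists k. assert (k <> 1 / 2) by (intros ->; lra). split; lra.
Qed.

Lemma kappa0_spec : 1 / 2 < kappa0 < 1 /\ ellM kappa0 = 0.
Proof.
  destruct ellM_root as (k & Hk & E).
  enough (kappa0 = k) as -> by auto.
  apply the_spec; [unfold ellM in E; split; lra|].
  intros q [Hq Eq]. assert (ellM q = 0) by (unfold ellM; lra).
  destruct (Rtotal_order q k) as [H1 | [H1 | H1]]; trivial; exfalso.
  - pose proof (ellM_decr q k ltac:(lra) ltac:(lra)). lra.
  - pose proof (ellM_decr k q ltac:(lra) ltac:(lra)). lra.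
Qed.

Lemma kE_incr (k q : R) : 0 < k < q -> q <= kappa0 -> k * ellE k < q * ellE q.
Proof.
  intros Hk Hq. destruct kappa0_spec as [H0 HM].
  assert (0 <= ellM q).
  { destruct (Rle_lt_or_eq_dec _ _ Hq) as [H | ->]; [|lra].
    pose proof (ellM_decr q kappa0 ltac:(lra) ltac:(lra)). lra. }
  pose proof (concavity k q ltac:(lra) ltac:(lra) ltac:(lra)). nra.
Qed.

(** The tangent at [k] has slope at most 0 and lies strictly above the value 1 taken at the endpoint
    1. *)
Lemma kE_gt_1_above_kappa0 (k : R) : kappa0 <= k < 1 -> 1 < k * ellE k.
Proof.
  intros Hk. destruct kappa0_spec as [H0 HM].
  assert (ellM k <= 0).
  { destruct (Rle_lt_or_eq_dec _ _ (proj1 Hk)) as [H | <-]; [|lra].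
    pose proof (ellM_decr kappa0 k ltac:(lra) ltac:(lra)). lra. }
  pose proof (concavity 1 k ltac:(lra) ltac:(lra) ltac:(lra)) as H1.
  rewrite ellE_1 in H1. nra.
Qed.

Lemma kE_continuous (k : R) : continuous (fun k => k * ellE k) k.
Proof.
  apply (continuous_mult (K := R_AbsRing)); [apply continuous_id | apply ellE_continuous].
Qed.

Lemma k0_spec : 1 / 2 < k0 < kappa0 /\ k0 * ellE k0 = 1.
Proof.
  destruct kappa0_spec as [H0 HM].
  pose proof (kE_gt_1_above_kappa0 kappa0 ltac:(lra)) as H1. pose proof kE_1_2.
  destruct (Ranalysis5.IVT_interv (fun k => k * ellE k - 1) (1 / 2) kappa0) as (k & Hk & E);
    try lra.
  { intros k _. apply continuity_pt_filterlim, (continuous_minus (V := R_NormedModule)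
      (fun k => k * ellE k) (fun _ => 1)); [apply kE_continuous | apply continuous_const]. }
  assert (k <> 1 / 2) by (intros ->; lra).
  assert (k <> kappa0) by (intros ->; lra).
  enough (k0 = k) as -> by (split; lra).
  apply the_spec; [rewrite F_plus_PI2; split; lra|].
  intros q [Hq Eq]. rewrite F_plus_PI2 in Eq.
  destruct (Rtotal_order q k) as [L | [L | L]]; trivial; exfalso.
  - pose proof (kE_incr q k ltac:(lra) ltac:(lra)). lra.
  - pose proof (kE_incr k q ltac:(lra) ltac:(lra)). lra.
Qed.

Lemma k0_bounds : 0 < k0 < 1.
Proof. pose proof k0_spec. pose proof kappa0_spec. lra. Qed.

Lemma kE_gt_1 (k : R) : k0 < k < 1 -> 1 < k * ellE k.
Proof.
  intros Hk. destruct k0_spec as [H0 H1].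
  destruct (Rle_lt_dec kappa0 k) as [H | H].
  - apply kE_gt_1_above_kappa0; lra.
  - rewrite <- H1. apply kE_incr; lra.
Qed.

Lemma kE_lt_1 (k : R) : 0 < k < k0 -> k * ellE k < 1.
Proof.
  intros Hk. destruct k0_spec as [H0 H1]. rewrite <- H1. apply kE_incr; lra.
Qed.

(** Serves [branch_gt_half]: with [ellE k0 = 1 / k0], it puts [4 / k0 ^ 2 - (1 + k0) ^ 2] below 4.
    It holds because [ellE_upper] gives [k * ellE k < 1] at [k = 0.7525]. *)
Lemma k0_lower : 7525 / 10000 < k0.
Proof.
  apply Rnot_le_lt. intros H. pose proof PI_upper. pose proof PI_RGT_0.
  assert (7525 / 10000 * ellE (7525 / 10000) < 1).
  { pose proof (ellE_upper (7525 / 10000) ltac:(lra)). nra. }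
  destruct (Rle_lt_or_eq_dec _ _ H) as [L | E].
  - pose proof (kE_gt_1 (7525 / 10000) ltac:(lra)). lra.
  - destruct k0_spec as [_ E1]. rewrite E in E1. lra.
Qed.

(** * The branch [t2] *)

Lemma continuous_F_plus_k (k t : R) : 0 <= t -> continuous (fun k => F_plus k t) k.
Proof.
  intros Ht. apply (continuous_minus (V := R_NormedModule)
    (fun k => k * sin t * Ik k t) (fun k => (1 - k * cos t) * speed k t)).
  - apply (continuous_mult (K := R_AbsRing) (fun k => k * sin t)).
    + apply (ex_derive_continuous (K := R_AbsRing) (V := R_NormedModule)); auto_derive; trivial.
    + apply (continuous_Ik_comp (fun k => k) (fun _ => t)); trivial.
      * apply continuous_id.
      * apply continuous_const.
  - apply (continuous_mult (K := R_AbsRing) (fun k => 1 - k * cos t)).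
    + apply (ex_derive_continuous (K := R_AbsRing) (V := R_NormedModule)); auto_derive; trivial.
    + apply continuous_sqrt_comp.
      apply (ex_derive_continuous (K := R_AbsRing) (V := R_NormedModule)); auto_derive; trivial.
Qed.

Lemma F_plus_continuity (k t : R) : 0 < k < 1 -> continuity_pt (F_plus k) t.
Proof.
  intros Hk. apply continuity_pt_filterlim.
  apply (ex_derive_continuous (K := R_AbsRing) (V := R_NormedModule)).
  eexists; apply is_derive_F_plus; trivial.
Qed.

Lemma F_plus_root (k : R) : k0 < k < 1 -> exists t, PI / 2 < t < PI /\ F_plus k t = 0.
Proof.
  intros Hk. pose proof k0_bounds. pose proof PI_RGT_0.
  pose proof (kE_gt_1 k Hk) as H1.
  pose proof (F_plus_PI2 k). pose proof (F_plus_PI k ltac:(lra)).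
  destruct (Ranalysis5.IVT_interv (fun t => - F_plus k t) (PI / 2) PI) as (t & Ht & E); try lra.
  - intros t _. apply continuity_pt_opp, F_plus_continuity; lra.
  - exists t. split; [|lra].
    assert (t <> PI / 2) by (intros ->; lra). assert (t <> PI) by (intros ->; lra). lra.
Qed.

Lemma t2_spec (k : R) : k0 < k < 1 -> PI / 2 < t2 k < PI /\ F_plus k (t2 k) = 0.
Proof.
  intros Hk. pose proof k0_bounds. destruct (F_plus_root k Hk) as (t & Ht & E).
  enough (t2 k = t) as -> by auto.
  apply the_spec; auto. intros u [Hu Eu].
  destruct (Rtotal_order u t) as [L | [L | L]]; trivial; exfalso.
  - pose proof (F_plus_decr k u t ltac:(lra) ltac:(lra) ltac:(lra)). lra.
  - pose proof (F_plus_decr k t u ltac:(lra) ltac:(lra) ltac:(lra)). lra.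
Qed.

(* [t2], extended by its limit [PI / 2] at [k0] *)
Definition t2_ext (k : R) : R := if Rle_dec k k0 then PI / 2 else t2 k.

Lemma t2_ext_above (k : R) : k0 < k -> t2_ext k = t2 k.
Proof. intros. unfold t2_ext. destruct (Rle_dec k k0); lra. Qed.

Lemma t2_ext_below (k : R) : k <= k0 -> t2_ext k = PI / 2.
Proof. intros. unfold t2_ext. destruct (Rle_dec k k0); lra. Qed.

Lemma t2_ext_spec (k : R) : k0 <= k < 1 -> PI / 2 <= t2_ext k < PI /\ F_plus k (t2_ext k) = 0.
Proof.
  intros [[H | <-] Hk].
  - rewrite t2_ext_above by trivial. pose proof (t2_spec k ltac:(lra)). lra.
  - rewrite t2_ext_below by lra. rewrite F_plus_PI2, (proj2 k0_spec).
    pose proof PI_RGT_0. lra.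
Qed.

Lemma lt_t2_ext (k t : R) : k0 <= k < 1 -> PI / 2 <= t <= PI -> 0 < F_plus k t -> t < t2_ext k.
Proof.
  intros Hk Ht HF. pose proof k0_bounds. pose proof (t2_ext_spec k Hk) as [H1 H2].
  apply Rnot_le_lt; intros [L | E]; [|rewrite E in H2; lra].
  pose proof (F_plus_decr k (t2_ext k) t ltac:(lra) ltac:(lra) ltac:(lra)). lra.
Qed.

Lemma t2_ext_lt (k t : R) : k0 <= k < 1 -> PI / 2 <= t <= PI -> F_plus k t < 0 -> t2_ext k < t.
Proof.
  intros Hk Ht HF. pose proof k0_bounds. pose proof (t2_ext_spec k Hk) as [H1 H2].
  apply Rnot_le_lt; intros [L | E]; [|rewrite <- E in H2; lra].
  pose proof (F_plus_decr k t (t2_ext k) ltac:(lra) ltac:(lra) ltac:(lra)). lra.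
Qed.

Lemma continuous_pos_near (f : R -> R) (x : R) : continuous f x -> 0 < f x ->
  exists d, 0 < d /\ forall y, Rabs (y - x) < d -> 0 < f y.
Proof.
  intros Hf Hx. apply continuity_pt_filterlim in Hf.
  destruct (Hf (f x) Hx) as (d & Hd & H). exists d; split; [exact Hd|].
  intros y Hy. destruct (Req_dec y x) as [-> | N]; trivial.
  assert (H1 : Rabs (f y - f x) < f x) by (apply H; repeat split; auto).
  apply Rabs_def2 in H1. lra.
Qed.

Lemma F_plus_neg_near (k t : R) : 0 <= t -> F_plus k t < 0 ->
  exists d, 0 < d /\ forall q, Rabs (q - k) < d -> F_plus q t < 0.
Proof.
  intros Ht HF. destruct (continuous_pos_near (fun q => - F_plus q t) k) as (d & Hd & H).
  - apply (continuous_opp (V := R_NormedModule)), continuous_F_plus_k; trivial.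
  - lra.
  - exists d; split; trivial. intros q Hq. specialize (H q Hq). lra.
Qed.

(** [F_plus k] is negative at [T + u] and, when [T - u > PI / 2], positive at [T - u]. Both signs
    persist for nearby moduli and trap [t2_ext] between these points. Otherwise [PI / 2] already
    bounds it below, and moduli up to [k0] are treated apart. *)
Lemma t2_ext_continuity (k : R) : k0 <= k < 1 -> continuity_pt t2_ext k.
Proof.
  intros Hk e He. pose proof k0_bounds as H0. pose proof PI_RGT_0.
  pose proof (t2_ext_spec k Hk) as [HT HF]. set (T := t2_ext k) in *.
  set (u := Rmin e ((PI - T) / 2)).
  assert (Hu : 0 < u) by (apply Rmin_glb_lt; lra).
  assert (Hu1 : u <= e) by apply Rmin_l.
  assert (Hu2 : u <= (PI - T) / 2) by apply Rmin_r. clearbody u.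
  destruct (F_plus_neg_near k (T + u)) as (d1 & Hd1 & K1); [lra| |].
  { rewrite <- HF. apply F_plus_decr; lra. }
  assert (K2 : exists d, 0 < d /\ forall q, k0 < q < 1 -> Rabs (q - k) < d -> T - u < t2_ext q).
  { destruct (Rle_lt_dec (T - u) (PI / 2)) as [L | L].
    - exists 1; split; [lra|]. intros q Hq _. rewrite t2_ext_above by lra.
      pose proof (t2_spec q Hq). lra.
    - destruct (continuous_pos_near (fun q => F_plus q (T - u)) k) as (d & Hd & K).
      + apply continuous_F_plus_k; lra.
      + rewrite <- HF. apply F_plus_decr; lra.
      + exists d; split; trivial. intros q Hq Hqk. apply lt_t2_ext; try lra. auto. }
  destruct K2 as (d2 & Hd2 & K2).
  assert (K3 : exists d, 0 < d /\ forall q, q <= k0 -> Rabs (q - k) < d -> t2_ext q = T).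
  { destruct (proj1 Hk) as [L | E].
    - exists (k - k0); split; [lra|]. intros q Hq Hqk. apply Rabs_def2 in Hqk. lra.
    - exists 1; split; [lra|]. intros q Hq _. unfold T. rewrite <- E, !t2_ext_below; lra. }
  destruct K3 as (d3 & Hd3 & K3).
  set (d := Rmin (Rmin d1 d2) (Rmin d3 (1 - k))).
  assert (Hd : 0 < d) by (repeat apply Rmin_glb_lt; lra).
  assert (Hd1' : d <= d1 /\ d <= d2 /\ d <= d3 /\ d <= 1 - k)
    by (unfold d; repeat split; eauto using Rle_trans, Rmin_l, Rmin_r).
  exists d; split; [exact Hd|]. clearbody d. intros q [_ Hq]. simpl in *. unfold R_dist in *.
  fold T.
  destruct (Rle_lt_dec q k0) as [L | L].
  - rewrite K3 by lra. rewrite Rminus_diag, Rabs_R0. exact He.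
  - assert (q < 1) by (apply Rabs_def2 in Hq; lra).
    pose proof (K2 q ltac:(lra) ltac:(lra)).
    pose proof (t2_ext_lt q (T + u) ltac:(lra) ltac:(lra) ltac:(apply K1; lra)).
    apply Rabs_def1; lra.
Qed.

(** * ** The parameter [a] along the zeros of [F_plus] *)

Lemma a2_alt (k t : R) : a2 k (PI - t) = k * sin t / (sqrt (1 - k ^ 2) * (1 - k * cos t)).
Proof.
  unfold a2. rewrite sin_PI_x, Rtrigo_facts.cos_pi_minus. f_equal. f_equal. ring.
Qed.

Lemma hits_of_F_plus (k t : R) : 0 < k < 1 -> F_plus k t = 0 -> hits 1 (a2 k (PI - t)) k t.
Proof.
  intros Hk HF. pose proof (minor_axis k Hk) as [Hb _].
  pose proof (w_pos 1 k t Hk ltac:(ring)). rewrite Rmult_1_l in *.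
  split; rewrite ?Rmult_1_l.
  - unfold F_plus in HF. fold (speed k t) in HF. lra.
  - rewrite a2_alt. field. lra.
Qed.

Lemma F_plus_of_hits (a k t : R) : 0 < k < 1 -> hits 1 a k t ->
  F_plus k t = 0 /\ a = a2 k (PI - t).
Proof.
  intros Hk [H1 H2]. pose proof (minor_axis k Hk) as [Hb _].
  pose proof (w_pos 1 k t Hk ltac:(ring)). rewrite !Rmult_1_l in *.
  split.
  - unfold F_plus. fold (speed k t). lra.
  - rewrite a2_alt, H2. field. lra.
Qed.

Lemma a2_pos (k t : R) : 0 < k < 1 -> 0 < t < PI -> 0 < a2 k (PI - t).
Proof.
  intros Hk Ht. pose proof (minor_axis k Hk) as [Hb _].
  pose proof (kcos_bounds k t Hk). rewrite a2_alt.
  apply Rdiv_lt_0_compat; apply Rmult_lt_0_compat; try lra. apply sin_gt_0; lra.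
Qed.

Lemma a2_length (k t : R) : 0 < k < 1 -> 0 < t < PI -> F_plus k t = 0 ->
  Ik k t ^ 2 - (1 - k * cos t) ^ 2 = / a2 k (PI - t) ^ 2.
Proof.
  intros Hk Ht HF. rewrite <- (hits_length 1 _ k t); trivial.
  - now rewrite Rmult_1_l.
  - apply a2_pos; trivial.
  - ring.
  - apply hits_of_F_plus; trivial.
Qed.

(** Built on [t2_ext] rather than [t2], so that it is continuous on the half-closed interval from
    [k0] and takes the value [a0] there; this lets the minimum be sought on a compact interval. *)
Definition branch (k : R) : R := a2 k (PI - t2_ext k).

Lemma branch_eq_a2 (k : R) : k0 < k -> branch k = a2 k (tau2 k).
Proof. intros. unfold branch, tau2. now rewrite t2_ext_above. Qed.

Lemma branch_k0 : branch k0 = a0.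
Proof.
  unfold branch, a0. rewrite a2_alt, t2_ext_below, sin_PI2, cos_PI2 by lra.
  pose proof (minor_axis k0 k0_bounds). field. lra.
Qed.

Lemma branch_pos (k : R) : k0 <= k < 1 -> 0 < branch k.
Proof.
  intros Hk. pose proof k0_bounds. pose proof PI_RGT_0. pose proof (t2_ext_spec k Hk).
  apply a2_pos; lra.
Qed.

Lemma branch_length (k : R) : k0 <= k < 1 ->
  Ik k (t2_ext k) ^ 2 - (1 - k * cos (t2_ext k)) ^ 2 = / branch k ^ 2.
Proof.
  intros Hk. pose proof k0_bounds. pose proof PI_RGT_0. pose proof (t2_ext_spec k Hk).
  apply a2_length; lra.
Qed.

Lemma le_of_inv_sqr (x y : R) : 0 < x -> 0 < y -> / y ^ 2 <= / x ^ 2 -> x <= y.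
Proof.
  intros Hx Hy H. apply Rnot_lt_le; intros L.
  assert (/ x ^ 2 < / y ^ 2) by (apply Rinv_lt_contravar; [apply Rmult_lt_0_compat; nra | nra]). lra.
Qed.

(** [F_plus k] is largest at [PI / 2], so a zero forces [k * ellE k >= 1]. As [t2_ext k] is the last
    zero before [PI], [Ik2_w2_lt] assigns it the least [a]. *)
Lemma branch_le (k t : R) : 0 < k < 1 -> 0 < t < PI -> F_plus k t = 0 ->
  k0 <= k /\ branch k <= a2 k (PI - t).
Proof.
  intros Hk Ht HF.
  assert (Hk0 : k0 <= k).
  { apply Rnot_lt_le; intros L. pose proof (kE_lt_1 k ltac:(lra)).
    pose proof (F_plus_le_PI2 k t Hk ltac:(lra)). rewrite F_plus_PI2 in *. lra. }
  split; trivial. pose proof (t2_ext_spec k ltac:(lra)) as [HT HFT].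
  apply le_of_inv_sqr; [apply branch_pos; lra|apply a2_pos; lra|].
  rewrite <- branch_length, <- a2_length by lra.
  destruct (Rtotal_order t (t2_ext k)) as [L | [<- | L]].
  - left; apply Ik2_w2_lt; lra.
  - apply Rle_refl.
  - pose proof (F_plus_decr k (t2_ext k) t ltac:(lra) ltac:(lra) ltac:(lra)). lra.
Qed.

Lemma branch_continuity (k : R) : k0 <= k < 1 -> continuity_pt branch k.
Proof.
  intros Hk. pose proof k0_bounds.
  pose proof (proj1 (continuity_pt_filterlim _ _) (t2_ext_continuity k Hk)) as HT.
  pose proof (minor_axis k ltac:(lra)) as [Hb _].
  pose proof (kcos_bounds k (t2_ext k) ltac:(lra)).
  apply continuity_pt_filterlim.
  apply (continuous_ext (fun k => k * sin (t2_ext k) *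
    / (sqrt (1 - k ^ 2) * (1 - k * cos (t2_ext k))))).
  { intros q. symmetry. apply a2_alt. }
  apply (continuous_mult (K := R_AbsRing) (fun k => k * sin (t2_ext k))).
  - apply (continuous_mult (K := R_AbsRing) (fun k => k)); [apply continuous_id|].
    apply continuous_sin_comp; trivial.
  - apply continuous_Rinv_comp; [|apply Rgt_not_eq, Rmult_lt_0_compat; lra].
    apply (continuous_mult (K := R_AbsRing) (fun k => sqrt (1 - k ^ 2))).
    + apply continuous_sqrt_comp.
      apply (ex_derive_continuous (K := R_AbsRing) (V := R_NormedModule)); auto_derive; trivial.
    + apply (continuous_minus (V := R_NormedModule) (fun _ => 1)); [apply continuous_const|].
      apply (continuous_mult (K := R_AbsRing) (fun k => k)); [apply continuous_id|].
      apply continuous_cos_comp; trivial.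
Qed.

(** * ** Growth and minimum of [branch] *)

Lemma Ik_le (k t : R) : 0 <= t -> Ik k t <= t.
Proof.
  intros Ht. pose proof (Ik_lipschitz k 0 t) as H.
  rewrite Ik_0, !Rminus_0_r, (Rabs_pos_eq t) in H by trivial.
  pose proof (Rle_abs (Ik k t)). lra.
Qed.

(** At [k = 1] both [I] and [w] equal [1 - cos t]. With [b = sqrt (1 - k ^ 2)], replacing [k] by 1
    costs at most [PI b] in [I] and [1 - k <= b] in [w], while [I + w <= PI + 2]; the constant 30
    bounds [(PI + 1) (PI + 2)]. *)
Lemma branch_large (k : R) : k0 <= k < 1 -> / branch k ^ 2 <= 30 * sqrt (1 - k ^ 2).
Proof.
  intros Hk. pose proof k0_bounds. pose proof PI_RGT_0. pose proof PI_upper.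
  pose proof (t2_ext_spec k Hk) as [HT _]. rewrite <- branch_length by trivial.
  set (t := t2_ext k) in *. clearbody t.
  pose proof (minor_axis k ltac:(lra)) as [Hb Hb2].
  pose proof (Ik_modulus k 1 t ltac:(lra)) as HI.
  replace (k ^ 2 - 1 ^ 2) with (- (1 - k ^ 2)) in HI by ring.
  rewrite Rabs_Ropp, (Rabs_pos_eq (1 - k ^ 2)), Ik_1 in HI by nra.
  pose proof (Rle_abs (Ik k t - (1 - cos t))).
  pose proof (Ik_le k t ltac:(lra)). pose proof (Ik_pos k t ltac:(lra) ltac:(lra)).
  pose proof (kcos_bounds k t ltac:(lra)). pose proof (COS_bound t).
  set (b := sqrt (1 - k ^ 2)) in *. clearbody b.
  assert (b < 1) by nra.
  assert (1 - k <= b) by nra.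
  assert (Ik k t - (1 - k * cos t) <= (PI + 1) * b) by nra.
  replace (_ - _) with ((Ik k t - (1 - k * cos t)) * (Ik k t + (1 - k * cos t))) by ring.
  apply Rle_trans with ((PI + 1) * b * (Ik k t + (1 - k * cos t))).
  - apply Rmult_le_compat_r; lra.
  - apply Rle_trans with ((PI + 1) * b * (PI + 2)).
    + apply Rmult_le_compat_l; nra.
    + assert ((PI + 1) * (PI + 2) <= 30) by nra. nra.
Qed.

Lemma cos_PI2_plus (x : R) : cos (PI / 2 + x) = - sin x.
Proof. rewrite cos_plus, cos_PI2, sin_PI2. ring. Qed.

Lemma sin_PI2_plus (x : R) : sin (PI / 2 + x) = cos x.
Proof. rewrite sin_plus, cos_PI2, sin_PI2. ring. Qed.

(* Since the derivative [k cos t psi] of [F_plus k] vanishes at [PI / 2], the loss is quadratic. *)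
Lemma F_plus_near_PI2 (k d : R) : 0 < k < 1 -> 0 < d < PI / 2 ->
  F_plus k (PI / 2) - PI * d ^ 2 <= F_plus k (PI / 2 + d).
Proof.
  intros Hk Hd.
  destruct (MVT_cor2 (F_plus k) (fun t => k * cos t * psi k t) (PI / 2) (PI / 2 + d))
    as (c & E & Hc); [lra| |].
  { intros c _. apply is_derive_Reals, is_derive_F_plus; trivial. }
  assert (Hp : 0 < psi k c <= PI).
  { split; [apply psi_pos; lra|]. apply Rle_trans with (Ik k c).
    - unfold psi. enough (0 <= k * sin c * (1 - k * cos c) / speed k c) by lra.
      pose proof (kcos_bounds k c Hk). pose proof (speed_pos k c Hk).
      assert (0 <= sin c) by (apply sin_ge_0; lra).
      apply Rdiv_le_0_compat; trivial. apply Rmult_le_pos; nra.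
    - pose proof (Ik_le k c ltac:(lra)). lra. }
  replace c with (PI / 2 + (c - PI / 2)) in E at 1 by ring. rewrite cos_PI2_plus in E.
  assert (Hs : 0 <= sin (c - PI / 2) <= d).
  { split; [apply sin_ge_0; lra|]. pose proof (sin_lt_x (c - PI / 2) ltac:(lra)). lra. }
  set (s := sin _) in *. clearbody s.
  assert (k * s <= d) by nra.
  assert (k * s * psi k c <= d * PI) by (apply Rmult_le_compat; nra).
  replace (PI / 2 + d - PI / 2) with d in E by ring. nra.
Qed.

(** Along the ray the logarithmic derivative at [d = 0] is [l / (k (1 - k ^ 2)) - k]. The slope [l]
    is half of the value that would make it vanish, leaving [- k / 2]. *)
Lemma a2_along_ray_decreasing (k l : R) : 0 < k < 1 -> l = k ^ 2 * (1 - k ^ 2) / 2 ->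
  exists e, 0 < e /\ forall d, 0 < d < e ->
    a2 (k + l * d) (PI - (PI / 2 + d)) < k / sqrt (1 - k ^ 2).
Proof.
  intros Hk Hl. pose proof (minor_axis k Hk) as [Hb Hb2].
  set (f := fun d => (k + l * d) * cos d / (sqrt (1 - (k + l * d) ^ 2) * (1 + (k + l * d) * sin d))).
  assert (Hf0 : f 0 = k / sqrt (1 - k ^ 2)).
  { unfold f. rewrite cos_0, sin_0, Rmult_0_r, Rplus_0_r. field. lra. }
  assert (Hd : is_derive f 0 (- (k ^ 2 / (2 * sqrt (1 - k ^ 2))))).
  { unfold f. auto_derive; rewrite ?cos_0, ?sin_0, ?Rmult_0_r, ?Rplus_0_r, ?Rmult_1_r.
    - repeat split; try nra. apply Rgt_not_eq.
      replace (1 + - (k * k)) with (1 - k ^ 2) by ring. lra.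
    - replace (1 + - (k * k)) with (1 - k ^ 2) by ring.
      set (b := sqrt _) in *. clearbody b.
      rewrite <- Hb2 in Hl. subst l.
      transitivity (k ^ 2 * (b ^ 2 + k ^ 2 - 2) / (2 * b)); [field; lra|].
      replace (b ^ 2 + k ^ 2 - 2) with (- 1) by lra. field. lra. }
  apply is_derive_Reals in Hd.
  (* The tolerance is the absolute value of the derivative, so every difference quotient in range is
     negative. *)
  destruct (Hd (k ^ 2 / (2 * sqrt (1 - k ^ 2)))) as ([e He] & H).
  { apply Rdiv_lt_0_compat; [apply pow_lt|]; lra. }
  exists e; split; trivial. intros d Hde.
  specialize (H d ltac:(lra)). simpl in H. rewrite Rabs_pos_eq in H by lra.
  specialize (H ltac:(lra)). rewrite Rplus_0_l in H. apply Rabs_def2 in H.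
  rewrite a2_alt, cos_PI2_plus, sin_PI2_plus, <- Hf0.
  replace (1 - (k + l * d) * - sin d) with (1 + (k + l * d) * sin d) by ring.
  change (f d < f 0). assert (Hq : (f d - f 0) / d < 0) by lra.
  apply Rmult_lt_compat_r with (r := d) in Hq; [|lra].
  unfold Rdiv in Hq. rewrite Rmult_assoc, Rinv_l in Hq; lra.
Qed.

(** Along the ray from [(k0, PI / 2)], increasing [k] raises [F_plus] at first order in [d], by
    concavity, while moving [t] costs only [PI * d ^ 2]. So [F_plus] is positive on the ray near its
    start, [t2_ext k] lies further right, and there [a2] is smaller still. *)
Lemma branch_below_a0 : exists k, k0 < k < 1 /\ branch k < a0.
Proof.
  pose proof k0_bounds as Hk0. pose proof kappa0_spec as [Hka HM0].
  pose proof k0_spec as [Hk0a HE0]. pose proof PI_RGT_0. pose proof PI_lower. pose proof PI_upper.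
  set (l := k0 ^ 2 * (1 - k0 ^ 2) / 2).
  assert (Hl : 0 < l <= 1).
  { unfold l. assert (0 < k0 ^ 2 < 1) by nra. nra. }
  destruct (a2_along_ray_decreasing k0 l Hk0 eq_refl) as (e & He & Ha). clearbody l.
  set (m := (k0 + kappa0) / 2). assert (Hm : k0 < m < kappa0) by (unfold m; lra).
  set (c := ellM m).
  assert (Hc : 0 < c) by (unfold c; rewrite <- HM0; apply ellM_decr; lra).
  (* The bounds serve, in order: the ray lemma; [k <= m], hence slope at least [c];
     [4 * d ^ 2 <= c * l * d], which beats the quadratic loss; and [d < PI / 2]. *)
  set (d := Rmin (Rmin (e / 2) (m - k0)) (Rmin (c * l / 4) 1)).
  assert (Hd : 0 < d) by (repeat apply Rmin_glb_lt; nra).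
  assert (Hd' : d <= e / 2 /\ d <= m - k0 /\ d <= c * l / 4 /\ d <= 1)
    by (unfold d; repeat split; eauto using Rle_trans, Rmin_l, Rmin_r).
  clearbody d. destruct Hd' as (D1 & D2 & D3 & D4).
  set (k := k0 + l * d). assert (Hk : k0 < k <= m) by (unfold k; nra).
  assert (HM : c <= ellM k).
  { destruct (proj2 Hk) as [L | ->]; [left; apply ellM_decr; lra | apply Rle_refl]. }
  assert (HF : 0 < F_plus k (PI / 2 + d)).
  { pose proof (F_plus_near_PI2 k d ltac:(lra) ltac:(lra)) as HF. rewrite F_plus_PI2 in HF.
    pose proof (concavity k0 k ltac:(lra) ltac:(lra) ltac:(lra)) as HC.
    assert (c * (l * d) <= ellM k * (k - k0)).
    { replace (k - k0) with (l * d) by (unfold k; ring).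
      apply Rmult_le_compat_r; trivial. nra. }
    assert (PI * d ^ 2 < 4 * d ^ 2) by (apply Rmult_lt_compat_r; nra).
    assert (4 * d ^ 2 <= c * l * d) by nra.
    nra. }
  exists k; split; [lra|].
  apply Rle_lt_trans with (a2 k (PI - (PI / 2 + d))); [|apply Ha; lra].
  pose proof (lt_t2_ext k (PI / 2 + d) ltac:(lra) ltac:(lra) HF) as HT.
  pose proof (t2_ext_spec k ltac:(lra)) as [HT' _].
  unfold branch. rewrite !a2_alt. set (t := t2_ext k) in *. clearbody t.
  pose proof (sin_decreasing_1 (PI / 2 + d) t ltac:(lra) ltac:(lra) ltac:(lra) ltac:(lra) HT).
  pose proof (cos_decreasing_1 (PI / 2 + d) t ltac:(lra) ltac:(lra) ltac:(lra) ltac:(lra) HT).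
  pose proof (minor_axis k ltac:(lra)) as [Hb _].
  pose proof (kcos_bounds k (PI / 2 + d) ltac:(lra)).
  assert (0 <= sin t) by (apply sin_ge_0; lra).
  apply Rmult_le_compat.
  - nra.
  - left; apply Rinv_0_lt_compat, Rmult_lt_0_compat; nra.
  - nra.
  - apply Rinv_le_contravar; [apply Rmult_lt_0_compat; nra|]. apply Rmult_le_compat_l; nra.
Qed.

Lemma branch_eventually_large (M q : R) : 0 < M -> q < 1 ->
  exists K, q < K < 1 /\ k0 < K /\ forall k, K <= k < 1 -> M < branch k.
Proof.
  intros HM Hq. pose proof k0_bounds as H0.
  set (e := / (31 * M ^ 2)).
  assert (HM2 : 0 < M ^ 2) by (apply pow_lt; trivial).
  assert (He : 0 < e) by (apply Rinv_0_lt_compat; lra).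
  assert (Hm : 30 * e < / M ^ 2).
  { unfold e. rewrite Rinv_mult. pose proof (Rinv_0_lt_compat _ HM2). lra. }
  clearbody e.
  (* [d <= e ^ 2 / 2] yields [1 - k ^ 2 <= 2 * d <= e ^ 2]; the 31 in [e] makes the comparison with
     the 30 of [branch_large] strict. *)
  set (d := Rmin (e ^ 2 / 2) (Rmin ((1 - q) / 2) ((1 - k0) / 2))).
  assert (Hd : 0 < d).
  { repeat apply Rmin_glb_lt; try lra. apply Rdiv_lt_0_compat; [apply pow_lt|]; lra. }
  assert (Hd' : d <= e ^ 2 / 2 /\ d <= (1 - q) / 2 /\ d <= (1 - k0) / 2)
    by (unfold d; repeat split; eauto using Rle_trans, Rmin_l, Rmin_r).
  clearbody d. exists (1 - d). repeat split; try lra.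
  intros k Hk. pose proof (branch_pos k ltac:(lra)).
  apply Rnot_le_lt; intros L.
  assert (/ M ^ 2 <= / branch k ^ 2).
  { apply Rinv_le_contravar; [apply pow_lt; trivial|]. apply pow_incr; lra. }
  pose proof (branch_large k ltac:(lra)).
  assert (sqrt (1 - k ^ 2) <= e).
  { rewrite <- (sqrt_pow2 e) by lra. apply sqrt_le_1_alt. nra. }
  lra.
Qed.

(** Beyond [K] the values exceed [a0], so a minimum over the compact interval from [k0] to [K] is
    global; a value below [a0] at [k1] keeps it away from [k0]. *)
Lemma branch_minimum : exists k, k0 < k < 1 /\ branch k < a0 /\ forall q, k0 <= q < 1 -> branch k <= branch q.
Proof.
  pose proof k0_bounds as H0. destruct branch_below_a0 as (k1 & Hk1 & H1).
  pose proof (branch_pos k0 ltac:(lra)) as Ha0. rewrite branch_k0 in Ha0.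
  destruct (branch_eventually_large a0 k1 Ha0 ltac:(lra)) as (K & HK & _ & HL).
  destruct (continuity_ab_min branch k0 K ltac:(lra)) as (k & Hmin & Hk).
  { intros; apply branch_continuity; lra. }
  pose proof (Hmin k1 ltac:(lra)).
  assert (k <> k0) by (intros ->; rewrite branch_k0 in *; lra).
  exists k. repeat split; try lra. intros q Hq.
  destruct (Rle_lt_dec q K) as [L | L]; [apply Hmin; lra|].
  pose proof (HL q ltac:(lra)). lra.
Qed.

Lemma branch_gt_half (k : R) : k0 < k < 1 -> 1 / 2 < branch k.
Proof.
  intros Hk. pose proof k0_bounds as H0. pose proof PI_RGT_0.
  pose proof (branch_pos k ltac:(lra)) as Hh.
  pose proof (branch_length k ltac:(lra)) as HL.
  pose proof (t2_ext_spec k ltac:(lra)) as [HT _].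
  pose proof (Ik2_w2_lt k (t2_ext k) PI ltac:(lra) ltac:(lra)) as HI.
  rewrite HL, Ik_PI, <- ellE_Ik, cos_PI in HI.
  assert (HE : ellE k <= ellE k0).
  { rewrite !ellE_Ik. apply RInt_le; try apply ex_RInt_speed; [lra|].
    intros x _. apply sqrt_le_1_alt. apply Rplus_le_compat_l, Ropp_le_contravar.
    apply Rmult_le_compat_r; [apply pow2_ge_0|]. nra. }
  destruct k0_spec as [_ HE0]. pose proof k0_lower.
  assert (0 < ellE k0) by nra.
  (* 1.329 exceeds 1 / 0.7525, and still [4 * 1.329 ^ 2 - 1.7525 ^ 2 < 4]. *)
  assert (ellE k0 < 1.329) by nra.
  assert (0 <= ellE k) by (rewrite ellE_Ik; left; apply Ik_pos; lra).
  assert (/ branch k ^ 2 < 4) by nra.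
  apply Rnot_le_lt; intros L.
  assert (/ (1 / 2) ^ 2 <= / branch k ^ 2).
  { apply Rinv_le_contravar; [apply pow_lt; trivial|]. apply pow_incr; lra. }
  lra.
Qed.

(** * ** Lower bounds for arc length by projections and chords *)

Lemma Ik_ge_projection (k t : R) : 0 < k < 1 -> 0 <= t <= PI -> 1 - cos t <= Ik k t.
Proof.
  intros Hk Ht. rewrite <- Ik_1 by trivial.
  apply RInt_le; try apply ex_RInt_speed; [lra|].
  intros x _. apply sqrt_le_1_alt, Rplus_le_compat_l, Ropp_le_contravar.
    apply Rmult_le_compat_r; [apply pow2_ge_0 | nra].
Qed.

(* The quarter ellipse is at least as long as its chord. *)
Lemma ellE_chord (k : R) : 0 < k < 1 -> sqrt (1 + (1 - k ^ 2)) <= ellE k.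
Proof.
  intros Hk. pose proof PI_RGT_0. rewrite ellE_Ik.
  set (c := sqrt (1 + (1 - k ^ 2))).
  assert (Hc : 0 < c) by (apply sqrt_lt_R0; nra).
  assert (Hc2 : c ^ 2 = 1 + (1 - k ^ 2)) by (apply pow2_sqrt; nra).
  clearbody c.
  (* The derivative of [f] is the component of the velocity along the chord direction [(-1, b) / c],
     where [b ^ 2 = 1 - k ^ 2]; Cauchy-Schwarz bounds it by the speed. *)
  set (f := fun x => (- cos x + (1 - k ^ 2) * sin x) / c).
  assert (HR : is_RInt (fun x => (sin x + (1 - k ^ 2) * cos x) / c) 0 (PI / 2)
    (minus (f (PI / 2)) (f 0))).
  { apply (is_RInt_derive (V := R_CompleteNormedModule) f).
    - intros x _. unfold f. auto_derive; trivial. field. lra.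
    - intros x _. apply (ex_derive_continuous (K := R_AbsRing) (V := R_NormedModule)).
      auto_derive; trivial. }
  replace c with (minus (f (PI / 2)) (f 0)).
  2:{ unfold f, minus, plus, opp; simpl. rewrite sin_0, cos_0, sin_PI2, cos_PI2.
      apply (Rmult_eq_reg_r c); [|lra]. field_simplify; lra. }
  rewrite <- (is_RInt_unique _ _ _ _ HR). apply RInt_le; [lra| |apply ex_RInt_speed|].
  { eexists; exact HR. }
  intros x Hx.
  assert (0 < sin x) by (apply sin_gt_0; lra). assert (0 < cos x) by (apply cos_gt_0; lra).
  assert (0 <= (sin x + (1 - k ^ 2) * cos x) / c).
  { apply Rdiv_le_0_compat; trivial. assert (0 < 1 - k ^ 2) by nra. nra. }
  rewrite <- (sqrt_pow2 (_ / c)) by trivial. apply sqrt_le_1_alt.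
  apply (Rmult_le_reg_r (c ^ 2)); [nra|].
  replace (((sin x + (1 - k ^ 2) * cos x) / c) ^ 2 * c ^ 2)
    with ((sin x + (1 - k ^ 2) * cos x) ^ 2) by (field; lra).
  rewrite Hc2.
  replace (1 - k ^ 2 * cos x ^ 2) with (sin x ^ 2 + (1 - k ^ 2) * cos x ^ 2)
    by (pose proof (cos2_sin2 x); lra).
  assert (0 <= (1 - k ^ 2) * (sin x - cos x) ^ 2)
    by (apply Rmult_le_pos; [nra | apply pow2_ge_0]).
  lra.
Qed.

Lemma Ik_PI_lower (k : R) : 0 < k < 1 -> 4 * (1 + (1 - k ^ 2)) <= Ik k PI ^ 2.
Proof.
  intros Hk. rewrite Ik_PI, <- ellE_Ik. pose proof (ellE_chord k Hk) as HE.
  rewrite <- (pow2_sqrt (1 + (1 - k ^ 2))) by nra.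
  pose proof (sqrt_pos (1 + (1 - k ^ 2))). nra.
Qed.

(** * Intersections beyond [PI] *)

(** Before [2 * PI] the sign of [sin t] forces [s = -1], and [I] is a half ellipse plus an arc
    bounded below by its projection. From [2 * PI] on, two half ellipses give [I >= 4], against
    [w <= 2]. *)
Lemma hits_beyond_PI (s a k t : R) : 0 < a -> 0 < k < 1 -> s ^ 2 = 1 -> PI <= t ->
  hits s a k t -> a < 1 / 2.
Proof.
  intros Ha Hk Hs Ht Hh. pose proof PI_RGT_0.
  pose proof (hits_length s a k t Ha Hk Hs Hh) as HL.
  enough (H4 : 4 + (1 - s * (k * cos t)) ^ 2 < Ik k t ^ 2).
  { apply Rnot_le_lt; intros L.
    assert (/ a ^ 2 <= / (1 / 2) ^ 2).
    { apply Rinv_le_contravar; [lra|]. apply pow_incr; lra. }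
    lra. }
  pose proof (Ik_PI_lower k Hk) as HP. pose proof (Ik_pos k PI Hk PI_RGT_0) as HP0.
  replace t with ((t - PI) + PI) at 2 by ring.
  rewrite Ik_shift_PI by lra. set (r := t - PI).
  destruct (Rlt_le_dec r PI) as [Hr | Hr].
  - assert (Hs1 : s = -1).
    { destruct Hh as [H1 _]. pose proof (w_pos s k t Hk Hs).
      pose proof (speed_pos k t Hk). pose proof (Ik_pos k t Hk ltac:(lra)) as HI.
      assert (0 < s * k * sin t).
      { apply (Rmult_lt_reg_r (Ik k t)); trivial. rewrite H1, Rmult_0_l.
        apply Rmult_lt_0_compat; trivial. }
      destruct (sign_cases s Hs) as [-> | ->]; trivial; exfalso.
      replace t with (r + PI) in * by (unfold r; ring). rewrite neg_sin in *.
      assert (0 <= sin r) by (apply sin_ge_0; unfold r in *; lra). nra. }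
    subst s. replace (cos t) with (- cos r)
      by (replace t with (r + PI) by (unfold r; ring); rewrite neg_cos; ring).
    pose proof (Ik_ge_projection k r Hk ltac:(unfold r in *; lra)) as HI.
    pose proof (COS_bound r). set (c := cos r) in *. set (I := Ik k r) in *.
    set (J := Ik k PI) in *. clearbody c I J.
    replace (1 - -1 * (k * - c)) with (1 - k * c) by ring.
    assert (0 <= J * I) by (apply Rmult_le_pos; lra).
    assert ((1 - c) ^ 2 <= I ^ 2) by (apply pow_incr; lra).
    (* The cross term [2 J I] is dropped. For [c > 0] the factor [1 - k] divides both the gain of
       [w ^ 2] over [(1 - c) ^ 2] and [4 * (1 - k ^ 2)]. *)
    enough ((1 - k * c) ^ 2 < (1 - c) ^ 2 + 4 * (1 - k ^ 2)) by nra.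
    destruct (Rle_lt_dec c 0).
    + assert (1 - k * c <= 1 - c) by nra. assert (0 <= 1 - k * c) by nra.
      assert (0 < 1 - k ^ 2) by nra. nra.
    + replace ((1 - k * c) ^ 2) with ((1 - c) ^ 2 + (1 - k) * (c * (2 - (1 + k) * c))) by ring.
      replace (1 - k ^ 2) with ((1 - k) * (1 + k)) by ring.
      assert (c * (2 - (1 + k) * c) < 4 * (1 + k)) by nra. nra.
  - replace r with ((r - PI) + PI) by ring. rewrite Ik_shift_PI by lra.
    assert (0 <= Ik k (r - PI)).
    { destruct Hr as [Hr | <-]; [left; apply Ik_pos; lra|]. rewrite Rminus_diag, Ik_0; lra. }
    assert (1 - s * (k * cos t) <= 2).
    { pose proof (kcos_bounds k t Hk). destruct (sign_cases s Hs) as [-> | ->]; lra. }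
    pose proof (w_pos s k t Hk Hs).
    set (J := Ik k PI) in *. set (w := 1 - s * (k * cos t)) in *. clearbody w J.
    assert (2 <= J) by nra. nra.
Qed.

(** * Covering (0, 1/2) *)

(** The polar angle of [(q, p)] by the tangent of its half: one formula, continuous off the negative
    axis. *)
Lemma half_angle (k p q : R) : 0 < k -> p ^ 2 + q ^ 2 = k ^ 2 -> 0 < k + q ->
  k * sin (2 * atan (p / (k + q))) = p /\ k * cos (2 * atan (p / (k + q))) = q.
Proof.
  intros Hk Hpq Hs. rewrite sin_2a, cos_2a, sin_atan, cos_atan.
  set (z := p / (k + q)).
  assert (Hz : 1 + z² = 2 * k / (k + q)).
  { unfold z, Rsqr. replace (1 + _) with ((p ^ 2 + q ^ 2 + k ^ 2 + 2 * k * q) / (k + q) ^ 2)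
      by (field; lra). rewrite Hpq. field. lra. }
  assert (0 < 1 + z²) by (pose proof (Rle_0_sqr z); lra).
  pose proof (sqrt_lt_R0 _ H) as Hr. pose proof (sqrt_sqrt (1 + z²) ltac:(lra)) as E.
  set (r := sqrt _) in *. clearbody r.
  replace (2 * (z / r) * (1 / r)) with (2 * z / (r * r)) by (field; lra).
  replace (1 / r * (1 / r) - z / r * (z / r)) with ((1 - z²) / (r * r))
    by (unfold Rsqr; field; lra).
  replace (1 - z²) with (2 - (1 + z²)) by ring. rewrite E, Hz. unfold z.
  split; field; lra.
Qed.

Lemma shift_nPI (k r : R) (n : nat) : 0 <= r ->
  Ik k (r + INR n * PI) = INR n * Ik k PI + Ik k r /\
  sin (r + INR n * PI) = (-1) ^ n * sin r /\ cos (r + INR n * PI) = (-1) ^ n * cos r.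
Proof.
  intros Hr. pose proof PI_RGT_0. induction n as [|n (H1 & H2 & H3)].
  - simpl. rewrite !Rmult_0_l, Rplus_0_r. repeat split; ring.
  - rewrite S_INR. replace (r + (INR n + 1) * PI) with ((r + INR n * PI) + PI) by ring.
    rewrite Ik_shift_PI, neg_sin, neg_cos, H1, H2, H3.
    + simpl. repeat split; ring.
    + pose proof (pos_INR n). nra.
Qed.

Lemma pow_m1_sqr (n : nat) : ((-1) ^ n) ^ 2 = 1.
Proof. rewrite <- pow_mult, Nat.mul_comm, pow_mult. replace ((-1) ^ 2) with 1 by ring. apply pow1. Qed.

(** The relation is the one at the end [x = 1] of the covering path; it gives [k ^ 2 <= 1 / 5], a
    nearly circular ellipse. *)
Lemma ellE_large (a k : R) : 0 < a < 1 / 2 -> 0 < k < 1 -> k ^ 2 * (1 + a ^ 2) = a ^ 2 ->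
  14 / 10 <= ellE k.
Proof.
  intros Ha Hk E. pose proof PI_lower. pose proof (minor_axis k Hk) as [Hb Hb2].
  pose proof (ellE_lower k ltac:(lra)) as HE.
  assert (k ^ 2 <= 1 / 5) by nra.
  assert (89 / 100 <= sqrt (1 - k ^ 2)) by nra. nra.
Qed.

Section Covering.

(* With [x = 1 - k cos r], the second equation of [hits] fixes [1 - k ^ 2] as a function of [x];
   [r] is then given by the half-angle formula [tan (r / 2) = k sin r / (k + k cos r)]. *)
Variables (a : R) (n : nat).
Hypothesis Ha : 0 < a < 1 / 2.

Let m (x : R) : R := 1 + a ^ 2 * x ^ 2.
Let b (x : R) : R := sqrt (x * (2 - x) / m x).
(** Solves [k ^ 2 = a ^ 2 (1 - k ^ 2) x ^ 2 + (1 - x) ^ 2], the sum of the squares of [k sin r] and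
    [k cos r]. *)
Let k (x : R) : R := sqrt (((1 - x) ^ 2 + a ^ 2 * x ^ 2) / m x).
(** The absolute value changes nothing on [0, 1]; it keeps [r] nonnegative at every real [x], as
    [continuous_Ik_comp] demands. *)
Let r (x : R) : R := 2 * atan (Rabs (a * b x * x / (k x + (1 - x)))).
(** At [t = r + n PI] with sign [(-1) ^ n], the second equation reduces the first to
    [Ik k t = sqrt (x ^ 2 + / a ^ 2)]. *)
Let defect (x : R) : R := INR n * Ik (k x) PI + Ik (k x) (r x) - sqrt (x ^ 2 + / a ^ 2).

Lemma cov_m_pos (x : R) : 0 < m x.
Proof. unfold m. pose proof (pow2_ge_0 (a * x)). nra. Qed.

Lemma cov_k2 (x : R) : 0 < k x /\ k x ^ 2 = ((1 - x) ^ 2 + a ^ 2 * x ^ 2) / m x.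
Proof.
  pose proof (cov_m_pos x).
  assert (0 < ((1 - x) ^ 2 + a ^ 2 * x ^ 2) / m x).
  { apply Rdiv_lt_0_compat; trivial. pose proof (pow2_ge_0 (1 - x)). pose proof (pow2_ge_0 (a * x)).
    destruct (Req_dec x 0) as [-> | N]; [lra|].
    assert (0 < (a * x) ^ 2) by (apply pow2_gt_0, Rmult_integral_contrapositive_currified; lra).
    lra. }
  split; [apply sqrt_lt_R0 | apply pow2_sqrt]; lra.
Qed.

Lemma cov_b2 (x : R) : 0 <= x <= 1 -> 0 <= b x /\ b x ^ 2 = x * (2 - x) / m x.
Proof.
  intros Hx. pose proof (cov_m_pos x). split; [apply sqrt_pos|]. apply pow2_sqrt.
  apply Rdiv_le_0_compat; trivial. nra.
Qed.

Lemma cov_b2_k2 (x : R) : 0 <= x <= 1 -> b x ^ 2 = 1 - k x ^ 2.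
Proof.
  intros Hx. pose proof (cov_m_pos x). rewrite (proj2 (cov_b2 x Hx)), (proj2 (cov_k2 x)).
  apply (Rmult_eq_reg_r (m x)); [|lra]. field_simplify; try lra. unfold m. ring.
Qed.

Lemma cov_legs (x : R) : 0 <= x <= 1 -> (a * b x * x) ^ 2 + (1 - x) ^ 2 = k x ^ 2.
Proof.
  intros Hx. pose proof (cov_m_pos x).
  replace ((a * b x * x) ^ 2) with (a ^ 2 * b x ^ 2 * x ^ 2) by ring.
  rewrite (proj2 (cov_b2 x Hx)), (proj2 (cov_k2 x)).
  apply (Rmult_eq_reg_r (m x)); [|lra]. field_simplify; try lra. unfold m. ring.
Qed.

Lemma cov_r_nonneg (x : R) : 0 <= r x.
Proof.
  unfold r. pose proof (Rabs_pos (a * b x * x / (k x + (1 - x)))) as [H | <-].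
  - apply atan_increasing in H. rewrite atan_0 in H. lra.
  - rewrite atan_0. lra.
Qed.

Lemma cov_angle (x : R) : 0 <= x <= 1 ->
  k x * sin (r x) = a * b x * x /\ k x * cos (r x) = 1 - x.
Proof.
  intros Hx. pose proof (cov_k2 x) as [Hk _]. pose proof (cov_b2 x Hx) as [Hb _].
  unfold r. rewrite Rabs_pos_eq.
  - apply half_angle; trivial; [apply cov_legs; trivial | lra].
  - apply Rdiv_le_0_compat; [|lra]. repeat apply Rmult_le_pos; lra.
Qed.

Lemma cov_defect_continuous (x : R) : 0 <= x <= 1 -> continuous defect x.
Proof.
  intros Hx. pose proof (cov_m_pos x). pose proof (cov_k2 x) as [Hk _].
  assert (Cb : continuous b x).
  { apply continuous_sqrt_comp, (ex_derive_continuous (K := R_AbsRing) (V := R_NormedModule)).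
    unfold m in *. auto_derive. simpl in *. lra. }
  assert (Ck : continuous k x).
  { apply continuous_sqrt_comp, (ex_derive_continuous (K := R_AbsRing) (V := R_NormedModule)).
    unfold m in *. auto_derive. simpl in *. lra. }
  assert (Cr : continuous r x).
  { apply (continuous_mult (K := R_AbsRing) (fun _ => 2)); [apply continuous_const|].
    apply continuous_atan_comp, continuous_Rabs_comp.
    apply (continuous_mult (K := R_AbsRing) (fun x => a * b x * x)).
    - apply (continuous_mult (K := R_AbsRing) (fun x => a * b x)); [|apply continuous_id].
      apply (continuous_mult (K := R_AbsRing) (fun _ => a)); trivial. apply continuous_const.
    - apply continuous_Rinv_comp; [|lra].
      apply (continuous_plus (V := R_NormedModule)); trivial.
      apply (ex_derive_continuous (K := R_AbsRing) (V := R_NormedModule)). auto_derive; trivial. }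
  apply (continuous_minus (V := R_NormedModule)
    (fun x => INR n * Ik (k x) PI + Ik (k x) (r x)) (fun x => sqrt (x ^ 2 + / a ^ 2))).
  - apply (continuous_plus (V := R_NormedModule) (fun x => INR n * Ik (k x) PI)).
    + apply (continuous_mult (K := R_AbsRing) (fun _ => INR n)); [apply continuous_const|].
      apply (continuous_Ik_comp k (fun _ => PI)); trivial; [|apply continuous_const].
      intros; left; apply PI_RGT_0.
    + apply (continuous_Ik_comp k r); trivial. apply cov_r_nonneg.
  - apply continuous_sqrt_comp, (ex_derive_continuous (K := R_AbsRing) (V := R_NormedModule)).
    auto_derive; trivial.
Qed.

Hypothesis Hn : 2 * INR n < / a <= 2 * INR n + 2.
Hypothesis Hn1 : 1 <= INR n.

Lemma cov_defect_0 : defect 0 < 0.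
Proof.
  assert (Ek : k 0 = 1).
  { unfold k, m. replace (_ / _) with (1 ^ 2) by (field; lra). apply sqrt_pow2; lra. }
  assert (Er : r 0 = 0).
  { unfold r. rewrite Rmult_0_r. unfold Rdiv. rewrite Rmult_0_l, Rabs_R0, atan_0. ring. }
  unfold defect. rewrite Ek, Er, Ik_0, Ik_PI, <- ellE_Ik, ellE_1.
  assert (0 < / a) by (apply Rinv_0_lt_compat; lra).
  replace (0 ^ 2 + / a ^ 2) with ((/ a) ^ 2) by (field; lra).
  rewrite sqrt_pow2; lra.
Qed.

(** Here [r = PI / 2], so the arc is [2 n + 1] quarter ellipses, each at least 1.4, against at most
    [sqrt (1 + (2 n + 2) ^ 2)]. The tightest case is [n = 1]: 17.64 against 17 after squaring. *)
Lemma cov_defect_1 : 0 < defect 1.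
Proof.
  pose proof PI_RGT_0.
  pose proof (cov_k2 1) as [Hk Hk2]. pose proof (cov_b2 1 ltac:(lra)) as [Hb Hb2].
  pose proof (cov_legs 1 ltac:(lra)) as HL. pose proof (cov_m_pos 1) as Hm.
  pose proof (cov_b2_k2 1 ltac:(lra)) as Hbk.
  assert (Er : r 1 = PI / 2).
  { unfold r. replace (a * b 1 * 1) with (k 1).
    - replace (k 1 / (k 1 + (1 - 1))) with 1 by (field; lra).
      rewrite Rabs_R1, atan_1. field.
    - assert (0 <= a * b 1) by nra. nra. }
  assert (HE : 14 / 10 <= ellE (k 1)).
  { apply (ellE_large a); trivial.
    - split; trivial. assert (0 < b 1 ^ 2).
      { rewrite Hb2. apply Rdiv_lt_0_compat; lra. }
      nra.
    - rewrite Hk2. unfold m. field. unfold m in Hm. lra. }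
  unfold defect. rewrite Er, Ik_PI, <- ellE_Ik.
  assert (sqrt (1 ^ 2 + / a ^ 2) < (2 * INR n + 1) * (14 / 10)); [|nra].
  assert (0 < / a) by (apply Rinv_0_lt_compat; lra).
  rewrite <- (sqrt_pow2 (_ * (14 / 10))) by nra. apply sqrt_lt_1_alt.
  replace (/ a ^ 2) with ((/ a) ^ 2) by (field; lra). nra.
Qed.

Lemma covering : exists q t, 0 < q < 1 /\ 0 < t /\ hits ((-1) ^ n) a q t.
Proof.
  destruct (Ranalysis5.IVT_interv defect 0 1) as (x & Hx & E).
  - intros x Hx. apply continuity_pt_filterlim, cov_defect_continuous; trivial.
  - lra.
  - apply cov_defect_0.
  - apply cov_defect_1.
  (* At [x = 0] the modulus would be 1; a zero of [defect] avoids it because [defect 0 < 0]. *)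
  - assert (Hx0 : 0 < x).
    { destruct (proj1 Hx) as [L | <-]; trivial. pose proof cov_defect_0. lra. }
    pose proof (cov_k2 x) as [Hk _]. pose proof (cov_b2 x Hx) as [Hb Hb2].
    pose proof (cov_m_pos x) as Hm.
    pose proof (cov_b2_k2 x Hx) as Hbk. pose proof (cov_angle x Hx) as [Hsin Hcos].
    pose proof (cov_r_nonneg x) as Hr.
    assert (Hb2' : 0 < b x ^ 2).
    { rewrite Hb2. apply Rdiv_lt_0_compat; nra. }
    assert (Hk1 : k x < 1) by nra.
    exists (k x), (r x + INR n * PI).
    pose proof PI_RGT_0.
    destruct (shift_nPI (k x) (r x) n Hr) as (H1 & H2 & H3).
    split; [lra|]. split; [nra|].
    unfold hits. unfold speed. rewrite H1, H2, H3.
    replace (((-1) ^ n * cos (r x)) ^ 2) with (((-1) ^ n) ^ 2 * cos (r x) ^ 2) by ring.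
    replace ((-1) ^ n * k x * ((-1) ^ n * sin (r x)))
      with (((-1) ^ n) ^ 2 * (k x * sin (r x))) by ring.
    replace ((-1) ^ n * (k x * ((-1) ^ n * cos (r x))))
      with (((-1) ^ n) ^ 2 * (k x * cos (r x))) by ring.
    rewrite pow_m1_sqr, !Rmult_1_l, Hsin, Hcos.
    replace (1 - k x ^ 2 * cos (r x) ^ 2) with ((a * b x) ^ 2 * (x ^ 2 + / a ^ 2)).
    2:{ replace (k x ^ 2 * cos (r x) ^ 2) with ((k x * cos (r x)) ^ 2) by ring.
        rewrite Hcos. pose proof (cov_legs x Hx) as HL.
        replace ((a * b x) ^ 2 * (x ^ 2 + / a ^ 2)) with ((a * b x * x) ^ 2 + b x ^ 2)
          by (field; lra). lra. }
    assert (0 <= a * b x) by nra.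
    rewrite <- Hbk, sqrt_pow2, sqrt_mult_alt, sqrt_pow2 by (trivial; apply pow2_ge_0).
    unfold defect in E.
    replace (INR n * Ik (k x) PI + Ik (k x) (r x)) with (sqrt (x ^ 2 + / a ^ 2)) by lra.
    split; ring.
Qed.

End Covering.

(** * ** The set of admissible parameters [a] *)

Lemma hits_upper_half (s a k t : R) : 0 < k < 1 -> s ^ 2 = 1 -> 0 < t < PI ->
  hits s a k t -> s = 1.
Proof.
  intros Hk Hs Ht [H1 _]. pose proof (w_pos s k t Hk Hs).
  pose proof (speed_pos k t Hk). pose proof (Ik_pos k t Hk ltac:(lra)) as HI.
  assert (0 < s * k * sin t).
  { apply (Rmult_lt_reg_r (Ik k t)); trivial. rewrite H1, Rmult_0_l.
    apply Rmult_lt_0_compat; trivial. }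
  assert (0 < sin t) by (apply sin_gt_0; lra).
  destruct (sign_cases s Hs) as [-> | ->]; trivial. nra.
Qed.

Lemma meets_iff_hits (a : R) : 0 < a ->
  (exists k, 0 < k < 1 /\ (meets_unit_circle_orthogonally (U_plus a k) \/
     meets_unit_circle_orthogonally (U_minus a k))) <->
  (exists s k t, s ^ 2 = 1 /\ 0 < k < 1 /\ 0 < t /\ hits s a k t).
Proof.
  intros Ha. split.
  - intros (k & Hk & [(t & Ht & H) | (t & Ht & H)]).
    + exists 1, k, t. repeat split; try lra; apply (orthogonal_hits 1 a k t); trivial; ring.
    + exists (-1), k, t. repeat split; try lra; apply (orthogonal_hits (-1) a k t); trivial; ring.
  - intros (s & k & t & Hs & Hk & Ht & H). exists k; split; trivial.
    pose proof (proj2 (orthogonal_hits s a k t Ha Hk Hs Ht) H) as H'.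
    destruct (sign_cases s Hs) as [-> | ->]; [left | right]; exists t; split; trivial.
Qed.

Theorem theorem4p12 :
  exists beta : R,
    is_min_on (fun k => a2 k (tau2 k)) k0 1 beta /\
    1 / 2 < beta < a0 /\
    forall a : R, 0 < a ->
      ((exists k : R, 0 < k < 1 /\
          (meets_unit_circle_orthogonally (U_plus a k) \/
           meets_unit_circle_orthogonally (U_minus a k))) <->
       (0 < a < 1 / 2 \/ beta <= a)).
Proof.
  pose proof k0_bounds as H0. pose proof PI_RGT_0.
  destruct branch_minimum as (km & Hkm & Hlt & Hmin).
  exists (branch km). split; [|split].
  - split.
    + exists km; split; trivial. symmetry; apply branch_eq_a2; lra.
    + intros k Hk. rewrite <- branch_eq_a2 by lra. apply Hmin; lra.
  - split; trivial. apply branch_gt_half; trivial.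
  - intros a Ha. rewrite meets_iff_hits by trivial. split.
    + intros (s & k & t & Hs & Hk & Ht & Hh).
      destruct (Rle_lt_dec PI t) as [L | L].
      * left. split; trivial. apply (hits_beyond_PI s a k t); trivial.
      * right. rewrite (hits_upper_half s a k t) in Hh by (trivial; lra).
        apply F_plus_of_hits in Hh; trivial. destruct Hh as [HF ->].
        destruct (branch_le k t) as [Hk0 Hle]; trivial; [lra|].
        eapply Rle_trans; [apply Hmin | exact Hle]; lra.
    + intros [Ha2 | Hge].
      * assert (Hinv : 2 < / a).
        { replace 2 with (/ (1 / 2)) by field. apply Rinv_lt_contravar; nra. }
        (* This floor is strict on the left, [n < 1 / (2 a) <= n + 1], which makes [defect] strictly
           negative at 0; [a < 1 / 2] excludes [n = 0]. *)
        destruct (nfloor1_ex (/ a / 2)) as [n Hn]; [lra|].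
        assert (1 <= INR n).
        { destruct n; [simpl in Hn; lra|]. rewrite S_INR. pose proof (pos_INR n). lra. }
        destruct (covering a n) as (k & t & Hk & Ht & Hh); try lra.
        exists ((-1) ^ n), k, t. repeat split; try lra; try apply pow_m1_sqr; apply Hh.
      (* [branch] takes the value [a] between its minimum at [km] and a modulus [K] where it already
         exceeds [a]. *)
      * assert (Hk : exists k, k0 < k < 1 /\ branch k = a).
        { destruct Hge as [Hge | <-]; [|exists km; auto].
          destruct (branch_eventually_large a km Ha ltac:(lra)) as (K & HK & _ & HL).
          pose proof (HL K ltac:(lra)).
          destruct (Ranalysis5.IVT_interv (fun k => branch k - a) km K) as (k & Hk & E); try lra.
          - intros k Hk. apply continuity_pt_minus; [apply branch_continuity; lra|].
            apply continuity_pt_const. intros ? ?; reflexivity.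
          - exists k. split; lra. }
        destruct Hk as (k & Hk & <-). pose proof (t2_ext_spec k ltac:(lra)) as [HT HF].
        exists 1, k, (t2_ext k). repeat split; try lra;
          apply hits_of_F_plus; trivial; lra.
Qed.
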